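(* Let $S$ be a Hausdorff space, with $\mathcal{B}(S)$ denoting its Borel sigma algebra. Let $\mathfrak{P}(S)$ be the space of all Borel probability measures on $S$ and let $\mathcal{B}(\mathfrak{P}(S))$ be the Borel sigma algebra on $\mathfrak{P}(S)$ with respect to the $A$-topology on $\mathfrak{P}(S)$. Let $(\Omega, \mathcal{F}, \mathbb{P})$ be a probability space and let $X_1, X_2, \ldots$ be a sequence of exchangeable $S$-valued random variables on it such that the common distribution of the $X_i$ is Radon on $S$. Then there exists a probability measure $\mathscr{Q}$ on $(\mathfrak{P}(S), \mathcal{B}(\mathfrak{P}(S)))$ such that, for all $k \in \mathbb{N}$, $$\mathbb{P}(X_1 \in B_1, \ldots, X_k \in B_k) = \int_{\mathfrak{P}(S)} \mu(B_1)\cdots \mu(B_k)\, d\mathscr{Q}(\mu) \quad \text{for all } B_1, \ldots, B_k \in \mathcal{B}(S). \qquad (\dagger)$$ Furthermore, all probability measures $\mathscr{Q}$ on $(\mathfrak{P}(S), \mathcal{B}(\mathfrak{P}(S)))$ satisfying $(\dagger)$ for all $k\in\mathbb{N}$ have the same restriction to the cylinder sigma algebra $\mathcal{C}(\mathfrak{P}(S))$.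
   Context: An $S$-valued random variable is an $(\mathcal{F},\mathcal{B}(S))$-measurable map $\Omega\to S$. The sequence $(X_n)_{n\in\mathbb{N}}$ is exchangeable if $\mathbb{P}(X_1\in B_1,\ldots,X_k\in B_k)=\mathbb{P}(X_{\sigma(1)}\in B_1,\ldots,X_{\sigma(k)}\in B_k)$ for all $k\in\mathbb{N}$, all permutations $\sigma$ of $\{1,\ldots,k\}$ and all $B_1,\ldots,B_k\in\mathcal{B}(S)$. A Borel probability measure $\mu$ on a Hausdorff space $T$ is Radon if $\mu(B)=\sup\{\mu(K): K\subseteq B,\ K \text{ compact}\}$ for every $B\in\mathcal{B}(T)$. The $A$-topology on $\mathfrak{P}(S)$ is the coarsest topology for which $\mu\mapsto\int_S f\,d\mu$ is upper semicontinuous for every bounded upper semicontinuous $f\colon S\to\mathbb{R}$; equivalently, it is generated by the subbasis of sets $\{\mu\in\mathfrak{P}(S):\mu(G)>\alpha\}$ with $G\subseteq S$ open and $\alpha\in\mathbb{R}$. The evaluation maps $\mu\mapsto\mu(B)$, $B\in\mathcal{B}(S)$, are Borel measurable for this topology. The cylinder sigma algebra $\mathcal{C}(\mathfrak{P}(S))$ is the smallest sigma algebra on $\mathfrak{P}(S)$ making all maps $\mu\mapsto\mu(B)$, $B\in\mathcal{B}(S)$, measurable; it is contained in $\mathcal{B}(\mathfrak{P}(S))$. *)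

(* Defs.v *)
From HB Require Import structures.
From mathcomp Require Import all_boot all_order all_algebra all_fingroup.
From mathcomp Require Import all_classical all_reals all_analysis.
From mathcomp Require Import measurable_realfun.

Set Implicit Arguments.
Unset Strict Implicit.
Unset Printing Implicit Defensive.

Import Order.TTheory GRing.Theory Num.Theory.
Import numFieldNormedType.Exports.

Local Open Scope classical_set_scope.
Local Open Scope ring_scope.

(* Borel sigma-algebra. A measurable type must be pointed, so [T] is a pointed
   space, which only excludes the empty one. *)
Notation borelType T := (g_sigma_algebraType (@open T)).

(* Real-valued mirror image of [lower_semicontinuous]. *)
Definition upper_semicontinuous {T : topologicalType} {R : numFieldType}
    (f : T -> R) :=
  forall x a, f x < a -> \forall y \near x, f y < a.

(* For a Hausdorff [T], where compact sets are closed, hence Borel. *)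
Definition radon {T : ptopologicalType} {R : realType}
    (mu : probability (borelType T) R) :=
  forall B : set (borelType T), measurable B ->
    mu B = ereal_sup [set mu K | K in [set K : set T | K `<=` B /\ compact K]].

Section A_topology.
Context (S : ptopologicalType) (R : realType).

(* Library measures also take values on non-measurable sets; everything below
   only depends on the values on Borel sets. *)
Definition borel_prob : Type := probability (borelType S) R.

HB.instance Definition _ := Pointed.on borel_prob.

(* The coarsest topology making every map [mu |-> \int[mu]_x f x] upper
   semicontinuous has as subbasis the preimages of the rays `]-oo, a[. *)
Definition A_subbase : set (set borel_prob) :=
  [set U | exists (f : S -> R) (a : R),
    [/\ upper_semicontinuous f, bounded_fun f &
        U = [set mu : borel_prob |
              (\int[mu]_(x in [set: borelType S]) (f x)%:E < a%:E)%E]]].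

HB.instance Definition _ :=
  isSubBaseTopological.Build borel_prob A_subbase id.

Definition cylinder : set (set borel_prob) :=
  <<s \bigcup_(B in (measurable : set (set (borelType S))))
        preimage_set_system [set: borel_prob] (fun mu => mu B)
          (measurable : set (set (\bar R))) >>.

End A_topology.

(* The sequence is indexed from 0; [k = 0] is harmless, here and below, as both
   sides are then total masses. *)
Definition exchangeable d d' (Omega : measurableType d) (T : measurableType d')
    (R : realType) (P : probability Omega R) (X : nat -> {RV P >-> T}) :=
  forall (k : nat) (s : {perm 'I_k}) (B : 'I_k -> set T),
    (forall i, measurable (B i)) ->
    P [set w | forall i : 'I_k, B i (X i w)] =
    P [set w | forall i : 'I_k, B i (X (s i) w)].

Definition mixture_of_iid d (Omega : measurableType d) (S : ptopologicalType)
    (R : realType) (P : probability Omega R)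
    (X : nat -> {RV P >-> borelType S})
    (Q : probability (borelType (borel_prob S R)) R) :=
  forall (k : nat) (B : 'I_k -> set (borelType S)),
    (forall i, measurable (B i)) ->
    P [set w | forall i : 'I_k, B i (X i w)] =
    (\int[Q]_(mu in [set: borelType (borel_prob S R)])
        \prod_(i < k) (mu : borel_prob S R) (B i))%E.

(* Main.v *)
Require Import Defs.
From HB Require Import structures.
From mathcomp Require Import all_boot all_order all_algebra all_fingroup.
From mathcomp Require Import all_classical all_reals all_analysis.
From mathcomp Require Import measurable_realfun.
From mathcomp Require Import ring lra zify.

(** Existence. By exchangeability, the expectation of a product of k empirical
frequencies of X 0, ..., X n is the joint probability on the left of the
mixture identity, up to the proportion of non-injective maps from k indices
to n.+1 indices, which vanishes as n grows ([moments_cvg]). So any limit law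
of the empirical measures should be a mixing measure. The difficulty is that
the Borel sigma-algebra of the A-topology can be much larger than the one
generated by the evaluations, and that the empirical measures need not be
Borel random elements for it; the limit is therefore not taken there.

Instead, a measure is seen as the family of its values, a point of the product
space of all functions from sets to reals, where the empirical measures stay in
a compact cube and only have to be measurable coordinate by coordinate. Limits
of their laws along an ultrafilter assign to every compact set of the product
a number, and these numbers form a content. A content on the compact sets of a
Hausdorff space always induces a measure on all Borel sets, by inner
approximation of the open sets ([content_probability]). This yields a Borel
probability lambda on the product space that integrates bounded continuous
functions to the limits of their empirical integrals ([limit_law]). It is
carried by the finitely additive set functions, since these form a closed set
containing all empirical measures.

A finitely additive z, restricted to the compact sets of S, is again a content.
The same construction turns it into a Borel measure Phi z, whose value at an
open G is the supremum of z C over the compact C included in G; it is a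
probability as soon as z is tight, and lambda-almost every z is tight because
the law of X 0 is Radon ([lambda_tight]). As a supremum of coordinates, Phi z G
is lower semicontinuous in z, which is exactly what makes Phi Borel for the
A-topology ([measurable_random_measure]). On a compact C, Phi z C is at least
z C; inner regularity of the law of X 0, applied to a Borel set B and to its
complement, then forces Phi z B and z B to agree in mean ([mean_dist_mass]).
Hence the image of lambda under Phi is a mixing measure.

Uniqueness. The mixture identity prescribes the integrals of all monomials in
the masses mu B. The law of a bounded real variable is determined by its
moments, even when it is weighted by another bounded factor
([sublevel_agree]); so the powers can be replaced by indicators of sublevel
sets, one mass at a time ([box_monomial_agree]). The resulting boxes are stable under intersection and
generate the cylinder sigma-algebra. *)

Import Order.TTheory GRing.Theory Num.Theory.
Import numFieldNormedType.Exports.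
Local Open Scope classical_set_scope.
Local Open Scope ring_scope.
Set Implicit Arguments.
Unset Strict Implicit.
Unset Printing Implicit Defensive.

(** * Separation of compact sets *)

(** Induction over a compact set: were [P] to fail on [C], the sets [A] with
[P (C `\` A)] would form a proper filter containing [C], and a point of [C] where
it clusters would have no neighbourhood satisfying [P]. *)
Lemma compact_ind (T : topologicalType) (C : set T) (P : set (set T)) :
  compact C -> P set0 -> (forall A B, P A -> P B -> P (A `|` B)) ->
  (forall A B, A `<=` B -> P B -> P A) ->
  (forall x, C x -> exists2 U, nbhs x U & P U) -> P C.
Proof.
move=> cC P0 PU Psub Ploc; apply: contrapT => nPC.
pose F : set_system T := [set A | P (C `\` A)].
have FF : ProperFilter F.
  apply: Build_ProperFilter_ex.
    move=> A FA; apply: contrapT => nA; apply: nPC; move: FA; rewrite /F/=.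
    apply: Psub => x Cx; split=> // Ax; apply: nA; by exists x.
  split; rewrite /F /=.
  - by rewrite setDT.
  - by move=> A B /= PA PB; rewrite setDIr; exact: PU.
  - by move=> A B AB; apply: Psub; exact: setDS.
have FC : F C by rewrite /F/= setDv.
have [x [Cx clx]] := cC F FF FC.
have [U nU PU'] := Ploc x Cx.
have FU : F (~` U) by rewrite /F/= setDE setCK; apply: Psub PU' => y [].
by have [y []] := clx _ _ FU nU.
Qed.

(** The separating sets are kept in a prescribed class [D] because a content
built from observations only sees the open sets that are observable. *)
Lemma separate_compacts (T : topologicalType) (D : set (set T)) :
  (forall U, D U -> open U) -> D set0 -> D setT ->
  (forall U V, D U -> D V -> D (U `|` V)) ->
  (forall U V, D U -> D V -> D (U `&` V)) ->
  (forall x y : T, x <> y ->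
    exists U V, [/\ D U, D V, U x, V y & U `&` V = set0]) ->
  forall A B : set T, compact A -> compact B -> A `&` B = set0 ->
  exists U V, [/\ D U, D V, A `<=` U, B `<=` V & U `&` V = set0].
Proof.
move=> Dop D0 DT DU DI Dsep A B cA cB AB0.
have pointB x : A x -> exists U V, [/\ D U, D V, U x, B `<=` V & U `&` V = set0].
  move=> Ax; apply: (compact_ind (P := fun B' =>
    exists U V, [/\ D U, D V, U x, B' `<=` V & U `&` V = set0]) cB).
  - exists setT, set0; split => //; by rewrite setI0.
  - move=> A1 A2 [U1 [V1 [dU1 dV1 U1x sV1 d1]]] [U2 [V2 [dU2 dV2 U2x sV2 d2]]].
    exists (U1 `&` U2), (V1 `|` V2); split; [exact: DI|exact: DU|by []| | ].
      by move=> z [/sV1|/sV2]; [left|right].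
    by rewrite setIUr setIAC d1 set0I -setIA d2 setI0 setU0.
  - move=> B1 B2 B12 [U [V [dU dV Ux sV d]]]; exists U, V; split => //.
    exact: subset_trans sV.
  - move=> y By.
    have xy : x <> y.
      by move=> xy; have : (A `&` B) x; [split => //; rewrite xy|rewrite AB0].
    have [U [V [dU dV Ux Vy d]]] := Dsep _ _ xy.
    exists V; first by apply: open_nbhs_nbhs; split => //; exact: Dop.
    by exists U, V; split.
apply: (compact_ind (P := fun A' =>
    exists U V, [/\ D U, D V, A' `<=` U, B `<=` V & U `&` V = set0]) cA).
- exists set0, setT; split => //; by rewrite set0I.
- move=> A1 A2 [U1 [V1 [dU1 dV1 U1x sV1 d1]]] [U2 [V2 [dU2 dV2 U2x sV2 d2]]].
  exists (U1 `|` U2), (V1 `&` V2); split; [exact: DU|exact: DI| | |].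
  + by move=> z [/U1x|/U2x]; [left|right].
  + by rewrite subsetI.
  + by rewrite setIUl setIA d1 set0I setICA d2 setI0 setU0.
- move=> B1 B2 B12 [U [V [dU dV Ux sV d]]]; exists U, V; split => //.
  exact: subset_trans Ux.
- move=> x /pointB [U [V [dU dV Ux BV d]]].
  exists U; first by apply: open_nbhs_nbhs; split => //; exact: Dop.
  by exists U, V; split.
Qed.

Lemma hausdorff_separate_compacts (T : topologicalType) (A B : set T) :
  hausdorff_space T -> compact A -> compact B -> A `&` B = set0 ->
  exists U V, [/\ open U, open V, A `<=` U, B `<=` V & U `&` V = set0].
Proof.
move=> hT; apply: separate_compacts => //.
- exact: open0.
- exact: openT.
- exact: openU.
- exact: openI.
- move=> x y xy; move: hT; rewrite open_hausdorff => hT.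
  have /eqP/hT [[U V] /= [xU yV] [oU oV /eqP UV]] := xy.
  by exists U, V; split => //; rewrite ?inE in xU yV *.
Qed.

(** The parts of [C] outside [U] and outside [V] are disjoint compact sets;
removing from [C] a neighbourhood of each of them gives the two pieces. *)
Lemma compact_split (T : topologicalType) (C U V : set T) :
  hausdorff_space T -> compact C -> open U -> open V -> C `<=` U `|` V ->
  exists C1 C2, [/\ compact C1, compact C2, C1 `<=` U, C2 `<=` V &
    C = C1 `|` C2].
Proof.
move=> hT cC oU oV CUV.
have cD W : open W -> compact (C `\` W).
  by move=> oW; rewrite setDE; apply: compact_closedI => //; exact: open_closedC.
have [|W1 [W2 [oW1 oW2 CW1 CW2 W12]]] :=
    hausdorff_separate_compacts (A := C `\` U) (B := C `\` V) hT (cD _ oU) (cD _ oV).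
  apply/seteqP; split => // x [[Cx nU] [_ nV]].
  by case: (CUV x Cx).
exists (C `\` W1), (C `\` W2); split; [exact: cD|exact: cD| | |].
- by move=> x [Cx nW]; apply: contrapT => nU; apply: nW; exact: CW1.
- by move=> x [Cx nW]; apply: contrapT => nU; apply: nW; exact: CW2.
- by rewrite -setDIr W12 setD0.
Qed.

(** * Borel measures from contents on compact sets *)

Section content.
Local Open Scope ereal_scope.
Variables (R : realType) (T : topologicalType).
Implicit Types (kappa : set T -> R) (A C G : set T).

(** A content in the sense of Halmos, with values in [R] so that it is finite on
compact sets. *)
Definition compact_content kappa :=
  [/\ forall C, compact C -> (0 <= kappa C)%R,
      forall C C', compact C -> compact C' -> C `<=` C' ->
        (kappa C <= kappa C')%R,
      forall C C', compact C -> compact C' ->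
        (kappa (C `|` C') <= kappa C + kappa C')%R &
      forall C C', compact C -> compact C' -> C `&` C' = set0 ->
        (kappa C + kappa C' <= kappa (C `|` C'))%R].

Definition inner_content kappa G : \bar R :=
  ereal_sup [set (kappa C)%:E | C in [set C | compact C /\ C `<=` G]].

Definition outer_content kappa A : \bar R :=
  ereal_inf [set inner_content kappa G | G in [set G | open G /\ A `<=` G]].

Lemma inner_content_ge kappa C G :
  compact C -> C `<=` G -> (kappa C)%:E <= inner_content kappa G.
Proof. by move=> cC CG; apply: ereal_sup_ubound; exists C. Qed.

Lemma inner_content_le kappa G x :
  (forall C, compact C -> C `<=` G -> (kappa C)%:E <= x) ->
  inner_content kappa G <= x.
Proof. by move=> h; apply: ge_ereal_sup => _ [C [cC CG] <-]; exact: h. Qed.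

Lemma inner_contentS kappa G G' :
  G `<=` G' -> inner_content kappa G <= inner_content kappa G'.
Proof.
move=> GG'; apply: inner_content_le => C cC CG; apply: inner_content_ge => //.
exact: subset_trans GG'.
Qed.

Lemma outer_content_le kappa A G :
  open G -> A `<=` G -> outer_content kappa A <= inner_content kappa G.
Proof. by move=> oG AG; apply: ereal_inf_lbound; exists G. Qed.

Lemma outer_content_ge kappa A x :
  (forall G, open G -> A `<=` G -> x <= inner_content kappa G) ->
  x <= outer_content kappa A.
Proof. by move=> h; apply: le_ereal_inf_tmp => _ [G [oG AG] <-]; exact: h. Qed.

Lemma outer_content_open kappa G :
  open G -> outer_content kappa G = inner_content kappa G.
Proof.
move=> oG; apply/eqP; rewrite eq_le outer_content_le//=.
by apply: outer_content_ge => G' _; exact: inner_contentS.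
Qed.

Lemma outer_contentS kappa A A' :
  A `<=` A' -> outer_content kappa A <= outer_content kappa A'.
Proof.
move=> AA'; apply: outer_content_ge => G oG A'G; apply: outer_content_le => //.
exact: subset_trans A'G.
Qed.

Lemma le_outer_content kappa C :
  compact C -> (kappa C)%:E <= outer_content kappa C.
Proof. by move=> cC; apply: outer_content_ge => G _; exact: inner_content_ge. Qed.

Lemma compact_content0 kappa : compact_content kappa -> kappa set0 = 0%R.
Proof.
move=> [_ _ sub add].
have := sub set0 set0 (@compact0 T) (@compact0 T).
have := add set0 set0 (@compact0 T) (@compact0 T) (setI0 _).
rewrite setU0; lra.
Qed.

Lemma inner_content_ge0 kappa G :
  compact_content kappa -> 0 <= inner_content kappa G.
Proof.
move=> k; have -> : 0 = (kappa set0)%:E by rewrite compact_content0.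
by apply: inner_content_ge; [exact: compact0|].
Qed.

Lemma outer_content_ge0 kappa A :
  compact_content kappa -> 0 <= outer_content kappa A.
Proof. by move=> k; apply: outer_content_ge => *; exact: inner_content_ge0. Qed.

(** Countable subadditivity comes from compactness: a compact subset of the union
lies in finitely many [G n], and [compact_split] distributes it among them. *)
Lemma inner_content_bigcup kappa (G : (set T)^nat) :
  hausdorff_space T -> compact_content kappa -> (forall n, open (G n)) ->
  inner_content kappa (\bigcup_n G n) <= \sum_(n <oo) inner_content kappa (G n).
Proof.
move=> hT k oG.
have fin N C : compact C -> C `<=` \big[setU/set0]_(i < N) G i ->
    (kappa C)%:E <= \sum_(i < N) inner_content kappa (G i).
  elim: N C => [|N IH] C cC.
    rewrite !big_ord0 subset0 => ->.
    by rewrite compact_content0.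
  rewrite !big_ord_recr /= => CG.
  have oU : open (\big[setU/set0]_(i < N) G i).
    by rewrite -bigcup_mkord; apply: bigcup_open.
  have [C1 [C2 [cC1 cC2 C1G C2G ->]]] := compact_split hT cC oU (oG N) CG.
  have [_ _ sub _] := k.
  apply: (@le_trans _ _ ((kappa C1)%:E + (kappa C2)%:E)).
    by rewrite -EFinD lee_fin sub.
  by apply: leeD; [exact: IH|exact: inner_content_ge].
apply: inner_content_le => C cC CG.
have [N CN] : exists N, C `<=` \big[setU/set0]_(i < N) G i.
  apply: (compact_ind (P := fun A => exists N, A `<=` \big[setU/set0]_(i < N) G i)
    cC).
  - by exists 0%N.
  - move=> A B [N AN] [M BM]; exists (maxn N M) => x.
    by move=> [/AN|/BM]; apply: subset_bigsetU; [exact: leq_maxl|exact: leq_maxr].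
  - by move=> A B AB [N BN]; exists N; exact: subset_trans BN.
  - move=> x /CG [n _ Gx]; exists (G n).
      by apply: open_nbhs_nbhs; split.
    by exists n.+1; rewrite big_ord_recr/=; apply: subsetUr.
apply: (le_trans (fin N C cC CN)).
rewrite -(big_mkord xpredT (fun i => inner_content kappa (G i))).
by apply: nneseries_lim_ge => *; exact: inner_content_ge0.
Qed.

Lemma outer_content_sigma_subadditive kappa :
  hausdorff_space T -> compact_content kappa ->
  sigma_subadditive (outer_content kappa).
Proof.
move=> hT k F; apply/lee_addgt0Pr => e e0.
have [G PG] : {G : nat -> set T & forall n, [/\ open (G n), F n `<=` G n &
    inner_content kappa (G n) <=
      outer_content kappa (F n) + (e / (2 ^ n.+1)%:R)%:E]}.
  apply: (@choice _ _ (fun n G => [/\ open G, F n `<=` G &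
    inner_content kappa G <=
      outer_content kappa (F n) + (e / (2 ^ n.+1)%:R)%:E])) => n.
  have en : (0 < e / (2 ^ n.+1)%:R)%R by rewrite divr_gt0// ltr0n expn_gt0.
  have [oo|fin] := eqVneq (outer_content kappa (F n)) +oo.
    exists setT; split => //; first exact: openT.
    by rewrite oo addye// leey.
  have ffin : outer_content kappa (F n) \is a fin_num.
    by rewrite ge0_fin_numE ?outer_content_ge0// ltey.
  have [_ [G [oG FG] <-] lt] := lb_ereal_inf_adherent en ffin.
  by exists G; split => //; exact/ltW.
apply: le_trans (epsilon_trick xpredT _ (ltW e0)); last first.
  by move=> n; exact: outer_content_ge0.
apply: (@le_trans _ _ (inner_content kappa (\bigcup_n G n))).
  apply: outer_content_le; first by apply: bigcup_open => n _; have [] := PG n.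
  by apply: subset_bigcup => n _; have [] := PG n.
apply: le_trans (inner_content_bigcup hT k _) _; first by move=> n; have [] := PG n.
apply: lee_nneseries; first by move=> *; exact: inner_content_ge0.
by move=> n _; have [] := PG n.
Qed.

(** Open sets are Caratheodory measurable. Given an open [H] containing [A], let a
compact [C] nearly exhaust the trace of [H] on [G], then let a compact set
nearly exhaust [H] minus [C], an open set that contains [A] minus [G]; these two
compact subsets of [H] are disjoint. *)
Lemma outer_content_open_split kappa G A :
  hausdorff_space T -> compact_content kappa -> open G ->
  outer_content kappa (A `&` G) + outer_content kappa (A `&` ~` G) <=
  outer_content kappa A.
Proof.
move=> hT k oG; apply: outer_content_ge => H oH AH.
apply: (@le_trans _ _ (inner_content kappa (H `&` G) +
    outer_content kappa (A `&` ~` G))).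
  apply: leeD2r; apply: outer_content_le; first exact: openI.
  exact: setSI.
have [Hy|Hfin] := eqVneq (inner_content kappa H) +oo.
  by rewrite Hy leey.
have Gfin A' : outer_content kappa (A `&` A') \is a fin_num.
  rewrite ge0_fin_numE ?outer_content_ge0//.
  rewrite (@le_lt_trans _ _ (inner_content kappa H)) ?ltey//.
  by apply: outer_content_le => // x [/AH].
rewrite -leeBrDr//; apply: inner_content_le => C cC CHG.
rewrite leeBrDr// addeC -leeBrDr//.
have clC : closed C by exact: compact_closed.
apply: (@le_trans _ _ (inner_content kappa (H `&` ~` C))).
  apply: outer_content_le.
    by apply: openI => //; exact: closed_openC.
  by move=> x [/AH Hx nG]; split => // /CHG [].
apply: inner_content_le => C' cC' C'H.
rewrite leeBrDr// -EFinD.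
have [_ _ _ add] := k.
apply: (@le_trans _ _ (kappa (C' `|` C))%:E).
  rewrite lee_fin add//; apply/seteqP; split => // x [/C'H []] //.
apply: inner_content_ge; first exact: compactU.
by move=> x [/C'H []|/CHG []].
Qed.

End content.

(** The measure is the Caratheodory restriction of the outer measure. Its values
at open sets are given by the content; at a compact set it can only exceed the
content, since it is an infimum over open neighbourhoods. *)
Lemma content_probability (R : realType) (T : ptopologicalType)
    (kappa : set T -> R) :
  hausdorff_space T -> compact_content kappa ->
  inner_content kappa setT = 1%E ->
  exists mu : probability (borelType T) R,
    (forall G : set T, open G -> mu G = inner_content kappa G) /\
    (forall C : set T, compact C -> (kappa C)%:E <= mu C)%E.
Proof.
move=> hT k k1.
have o0 : outer_content kappa set0 = 0%E.
  rewrite outer_content_open; last exact: open0.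
  apply/eqP; rewrite eq_le inner_content_ge0// andbT.
  apply: inner_content_le => C _; rewrite subset0 => ->.
  by rewrite compact_content0.
pose O : {outer_measure set T -> \bar R} := HB.pack (outer_content kappa)
  (isOuterMeasure.Build R T (outer_content kappa) o0
    (fun A => outer_content_ge0 A k) (fun A B => @outer_contentS _ _ kappa A B)
    (outer_content_sigma_subadditive hT k)).
pose mu : set (borelType T) -> \bar R := outer_content kappa.
have borel_cara (A : set (borelType T)) :
    measurable A -> measurable (A : set (caratheodory_type O)).
  apply: (smallest_sub (sigma_algebra_measurable (caratheodory_type O))) => G oG.
  by apply: (@le_caratheodory_measurable _ _ O) => X; exact: outer_content_open_split.
have sadd : semi_sigma_additive mu.
  move=> F mF tF mUF.
  by apply: (@caratheodory_measure_sigma_additive R T O F) => // *; exact: borel_cara.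
have muT : mu setT = 1%E by rewrite /mu outer_content_open//; exact: openT.
pose m := isMeasure.Build _ (borelType T) R mu o0
  (fun A => outer_content_ge0 A k) sadd.
pose M : {measure set (borelType T) -> \bar R} := HB.pack mu m.
pose P : probability (borelType T) R :=
  HB.pack mu m (Measure_isProbability.Build _ (borelType T) R M muT).
exists P; split.
- by move=> G oG; rewrite -outer_content_open.
- by move=> C cC; exact: le_outer_content.
Qed.

(** * Integrals of bounded functions against a probability *)

Section Rintegral_probability.
Context d (T : measurableType d) (R : realType) (P : probability T R).
Implicit Types (f g : T -> R).

Lemma bounded_integrable f (c : R) :
  measurable_fun setT f -> (forall x, `|f x| <= c) ->
  P.-integrable setT (EFin \o f).
Proof.
move=> mf fc; apply: measurable_bounded_integrable => //.
  by rewrite [ltLHS]probability_setT ltry.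
exists c; split; first exact: num_real.
by move=> e ce x _; apply: le_trans (fc x) (ltW ce).
Qed.

Lemma EFin_Rintegral f : P.-integrable setT (EFin \o f) ->
  (\int[P]_x (f x)%:E)%E = (\int[P]_x f x)%:E.
Proof. by move=> intf; rewrite /Rintegral fineK//; exact: integrable_fin_num. Qed.

Lemma Rintegral_indic (A : set T) : measurable A ->
  \int[P]_x \1_A x = fine (P A).
Proof. by move=> mA; rewrite /Rintegral integral_indic// setIT. Qed.

Lemma Rintegral_sum I (s : seq I) (h : I -> T -> R) :
  (forall i, P.-integrable setT (EFin \o h i)) ->
  \int[P]_x (\sum_(i <- s) h i x) = \sum_(i <- s) \int[P]_x h i x.
Proof.
move=> inth; elim: s => [|a s IH].
  rewrite big_nil; under eq_Rintegral do rewrite big_nil.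
  by rewrite Rintegral_cst// mul0r.
rewrite big_cons -IH; under eq_Rintegral do rewrite big_cons.
rewrite RintegralD//.
have -> : EFin \o (fun x => \sum_(i <- s) h i x) =
    (fun x => \sum_(i <- s) (h i x)%:E)%E by apply/funext => x /=; rewrite sumEFin.
by apply: integrable_sum => // i _; exact: inth.
Qed.

Lemma Rintegral_cst1 (c : R) : \int[P]_x c = c.
Proof. by rewrite Rintegral_cst// [X in fine X]probability_setT mulr1. Qed.

Lemma EFin_fine_measure (A : set T) : measurable A -> (fine (P A))%:E = P A.
Proof. by move=> mA; rewrite fineK// fin_num_measure. Qed.

Lemma fine_prob01 (A : set T) : measurable A -> 0 <= fine (P A) <= 1.
Proof.
move=> mA; rewrite fine_ge0//= -lee_fin EFin_fine_measure//.
exact: probability_le1.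
Qed.

Lemma integrable_EFinB f g :
  P.-integrable setT (EFin \o f) -> P.-integrable setT (EFin \o g) ->
  P.-integrable setT (EFin \o (fun x => f x - g x)).
Proof.
move=> intf intg; rewrite (_ : _ \o _ = ((EFin \o f) \- (EFin \o g))%E)//.
exact: integrableB.
Qed.

Lemma integrable_EFinD f g :
  P.-integrable setT (EFin \o f) -> P.-integrable setT (EFin \o g) ->
  P.-integrable setT (EFin \o (fun x => f x + g x)).
Proof.
move=> intf intg; rewrite (_ : _ \o _ = ((EFin \o f) \+ (EFin \o g))%E)//.
exact: integrableD.
Qed.

Lemma le_Rintegral_as (A : set T) f g :
  measurable A -> P A = 1%E ->
  P.-integrable setT (EFin \o f) -> P.-integrable setT (EFin \o g) ->
  (forall x, A x -> f x <= g x) -> \int[P]_x f x <= \int[P]_x g x.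
Proof.
move=> mA PA intf intg fg.
have PCA : P (~` A) = 0%E by rewrite probability_setC// PA subee.
have onA (h : T -> R) : P.-integrable setT (EFin \o h) ->
    \int[P]_x h x = \int[P]_(x in A) h x.
  move=> inth; rewrite /Rintegral.
  rewrite (negligible_integral (measurableC mA) measurableT inth PCA).
  by rewrite setDE setCK setTI.
have intA (h : T -> R) : P.-integrable setT (EFin \o h) ->
    P.-integrable A (EFin \o h).
  by move=> inth; exact: integrableS inth.
by rewrite !onA//; apply: le_Rintegral => //; exact: intA.
Qed.

End Rintegral_probability.

Section layers.
Context (R : realType).

(** With [le_sum_lt]: the number of positive integers below [x] differs from [x]
by at most one. This is the layer cake formula for a step of length one. *)
Lemma sum_lt_le (x : R) N : 0 <= x -> \sum_(i < N) (i.+1%:R < x)%R%:R <= x.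
Proof.
move=> x0; elim: N => [|N IH]; first by rewrite big_ord0.
rewrite big_ord_recr/=; case: (ltP N.+1%:R x) => [Nx|_]; last by rewrite addr0.
apply: le_trans (ltW Nx); rewrite -natr1 lerD2r.
rewrite -[leRHS]mulr1 mulr_natl -[in leRHS](card_ord N) -sumr_const.
by apply: ler_sum => i _; case: ltP.
Qed.

Lemma le_sum_lt (x : R) N : x <= N.+1%:R ->
  x <= \sum_(i < N) (i.+1%:R < x)%R%:R + 1.
Proof.
elim: N => [|N IH]; first by rewrite big_ord0 add0r.
move=> xN; have [xN1|Nx] := leP x N.+1%:R.
  rewrite big_ord_recr/= ltNge xN1/= addr0; exact: IH.
rewrite (eq_bigr (fun=> 1)); last first.
  move=> i _; rewrite (le_lt_trans _ Nx)//.
  by rewrite ler_nat.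
by rewrite sumr_const card_ord natr1.
Qed.

(** The superlevel sets at the heights (i+1)/(N+1). They reduce an integral to
finitely many measures of sets, which are open when [h] is lower
semicontinuous. *)
Definition layer T (h : T -> R) N i : set T := [set y | i.+1%:R / N.+1%:R < h y].

Definition layer_sum T (h : T -> R) N y : R :=
  N.+1%:R^-1 * \sum_(i < N.+1) \1_(layer h N i) y.

Lemma layer_sumE T (h : T -> R) N y : layer_sum h N y =
  N.+1%:R^-1 * \sum_(i < N.+1) (i.+1%:R < N.+1%:R * h y)%R%:R.
Proof.
congr (_ * _); apply: eq_bigr => i _; rewrite indicE.
have -> : (y \in layer h N i) = (i.+1%:R / N.+1%:R < h y).
  by apply/idP/idP; rewrite inE.
by rewrite ltr_pdivrMr ?ltr0n// mulrC.
Qed.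

Lemma layer_sum_le T (h : T -> R) N y : 0 <= h y -> layer_sum h N y <= h y.
Proof.
move=> h0; rewrite layer_sumE mulrC ler_pdivrMr ?ltr0n// mulrC.
by apply: sum_lt_le; rewrite mulr_ge0.
Qed.

Lemma le_layer_sum T (h : T -> R) N y : h y <= 1 ->
  h y <= layer_sum h N y + N.+1%:R^-1.
Proof.
move=> h1; rewrite layer_sumE -{2}[_^-1]mulr1 -mulrDr.
rewrite [leRHS]mulrC ler_pdivlMr ?ltr0n// mulrC.
apply: le_sum_lt; apply: (@le_trans _ _ N.+1%:R).
  by rewrite -[leRHS]mulr1 ler_wpM2l.
by rewrite ler_nat.
Qed.

Context d (T : measurableType d) (P : probability T R).

Lemma integrable_layer_sum (h : T -> R) N :
  (forall i, measurable (layer h N i)) ->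
  P.-integrable setT (EFin \o layer_sum h N).
Proof.
move=> mh.
have -> : EFin \o layer_sum h N = (fun y => (N.+1%:R^-1)%:E *
   (\sum_(i < N.+1) (\1_(layer h N i) y)%:E)%R)%E.
  by apply/funext => y /=; rewrite sumEFin -EFinM.
apply: integrableZl => //; apply: integrable_sum => // i _.
exact: integrable_indic.
Qed.

Lemma Rintegral_layer_sum (h : T -> R) N :
  (forall i, measurable (layer h N i)) ->
  \int[P]_y layer_sum h N y = N.+1%:R^-1 * \sum_(i < N.+1) fine (P (layer h N i)).
Proof.
move=> mh; rewrite RintegralZl//; last first.
  rewrite (_ : _ \o _ =
     (fun y => (\sum_(i < N.+1) (\1_(layer h N i) y)%:E)%R)%E); last first.
    by apply/funext => y /=; rewrite sumEFin.
  by apply: integrable_sum => // i _; exact: integrable_indic.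
rewrite Rintegral_sum; last by move=> i; exact: integrable_indic.
by congr (_ * _); apply: eq_bigr => i _; rewrite Rintegral_indic.
Qed.

Lemma Rintegral_layer_bounds (h : T -> R) N :
  measurable_fun setT h -> (forall y, 0 <= h y <= 1) ->
  N.+1%:R^-1 * \sum_(i < N.+1) fine (P (layer h N i)) <= \int[P]_y h y <=
  N.+1%:R^-1 * \sum_(i < N.+1) fine (P (layer h N i)) + N.+1%:R^-1.
Proof.
move=> mh h01.
have ml i : measurable (layer h N i).
  have := mh measurableT `]i.+1%:R / N.+1%:R, +oo[%classic (measurable_itv _).
  rewrite setTI; congr measurable; apply/seteqP.
  by split => y /=; rewrite in_itv/= andbT.
have ih : P.-integrable setT (EFin \o h).
  apply: (@bounded_integrable _ _ _ _ _ 1) => // y.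
  by have /andP[h0 h1] := h01 y; rewrite ger0_norm.
rewrite -Rintegral_layer_sum//; apply/andP; split.
  apply: le_Rintegral => //; first exact: integrable_layer_sum.
  by move=> y _; apply: layer_sum_le; have /andP[] := h01 y.
rewrite -[X in _ + X](Rintegral_cst1 P) -RintegralD//; first last.
- exact: finite_measure_integrable_cst.
- exact: integrable_layer_sum.
apply: le_Rintegral => //.
- apply: integrable_EFinD; first exact: integrable_layer_sum.
  exact: finite_measure_integrable_cst.
- by move=> y _; apply: le_layer_sum; have /andP[] := h01 y.
Qed.

End layers.

(** * Limit laws along an ultrafilter *)

(** Limits are taken along an ultrafilter rather than as upper or lower limits,
because the limiting mass has to be additive. *)
Lemma ultra_fmap T T' (f : T -> T') (U : set_system T) :
  UltraFilter U -> UltraFilter (f @ U).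
Proof.
move=> UU; split; first exact: fmap_proper_filter.
move=> G GF fUG; apply/seteqP; split => // A GA.
have [//|nA] := in_ultra_setVsetC (f @^-1` A) UU.
have : G (A `&` ~` A) by apply: filterI => //; exact: fUG.
by rewrite setICr => /filter_not_empty.
Qed.

Lemma ultra_bounded_cvg (R : realType) (U : set_system nat) (a : nat -> R) :
  UltraFilter U -> (forall n, 0 <= a n <= 1) -> cvg (a @ U).
Proof.
move=> UU a01; have aU := ultra_fmap a UU.
have : compact `[0, 1 : R]%classic by exact: segment_compact.
rewrite compact_ultra => /(_ (a @ U) aU) [|l [_ al]]; last by apply/cvg_ex; exists l.
have aI n : `[0, 1 : R]%classic (a n) by rewrite /= in_itv/= a01.
exact: (nearW _ aI).
Qed.

Section limit_law.
Context d (Omega : measurableType d) (R : realType) (P : probability Omega R).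
Context (Z : ptopologicalType) (K : set Z) (E : nat -> Omega -> Z).
Context (U : set_system nat) {UU : UltraFilter U}.

(** The sets [E n @^-1` D] need not be measurable for every open [D]: the law of
[E n] is known only on these open sets. *)
Definition observable (D : set Z) :=
  open D /\ forall n, measurable (E n @^-1` D).

Definition limit_mass (D : set Z) : R :=
  lim ((fun n => fine (P (E n @^-1` D))) @ U).

Lemma cvg_limit_mass D : observable D ->
  (fun n => fine (P (E n @^-1` D))) @ U --> limit_mass D.
Proof.
by move=> [_ mD]; apply: ultra_bounded_cvg => // n; exact: fine_prob01.
Qed.

Lemma observable0 : observable set0.
Proof. by split; [exact: open0|move=> n; rewrite preimage_set0]. Qed.

Lemma observableT : observable setT.
Proof. by split; [exact: openT|move=> n; rewrite preimage_setT]. Qed.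

Lemma observableU A B : observable A -> observable B -> observable (A `|` B).
Proof.
move=> [oA mA] [oB mB]; split; first exact: openU.
by move=> n; rewrite preimage_setU; exact: measurableU.
Qed.

Lemma observableI A B : observable A -> observable B -> observable (A `&` B).
Proof.
move=> [oA mA] [oB mB]; split; first exact: openI.
by move=> n; rewrite preimage_setI; exact: measurableI.
Qed.

Lemma limit_mass_ge0 D : observable D -> 0 <= limit_mass D.
Proof.
move=> oD; apply: limr_ge; first exact: cvg_limit_mass oD.
by apply: nearW => n; rewrite fine_ge0.
Qed.

Lemma limit_mass_le A B : observable A -> observable B -> A `<=` B ->
  limit_mass A <= limit_mass B.
Proof.
move=> oA oB AB; apply: ler_cvg_to (cvg_limit_mass oA) (cvg_limit_mass oB) _.
apply: nearW => n; have [_ mA] := oA; have [_ mB] := oB.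
rewrite fine_le ?fin_num_measure//; apply: le_measure; rewrite ?inE//.
exact: preimage_subset.
Qed.

Lemma limit_massU_le A B : observable A -> observable B ->
  limit_mass (A `|` B) <= limit_mass A + limit_mass B.
Proof.
move=> oA oB; apply: ler_cvg_to (cvg_limit_mass (observableU oA oB))
  (cvgD (cvg_limit_mass oA) (cvg_limit_mass oB)) _.
apply: nearW => n; have [_ mA] := oA; have [_ mB] := oB.
have mU := measurableU _ _ (mA n) (mB n).
rewrite preimage_setU -lee_fin EFinD !EFin_fine_measure//.
exact: measureU2.
Qed.

Lemma limit_massU A B : observable A -> observable B -> A `&` B = set0 ->
  limit_mass (A `|` B) = limit_mass A + limit_mass B.
Proof.
move=> oA oB AB; apply: cvg_lim => //.
rewrite (_ : (fun n => _) = (fun n => fine (P (E n @^-1` A)) +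
    fine (P (E n @^-1` B)))).
  by apply: cvgD; exact: cvg_limit_mass.
apply/funext => n; have [_ mA] := oA; have [_ mB] := oB.
rewrite preimage_setU measureU ?fineD ?fin_num_measure//.
by rewrite -preimage_setI AB preimage_set0.
Qed.

Hypothesis KE : forall n w, K (E n w).

Lemma limit_mass_K D : K `<=` D -> limit_mass D = 1.
Proof.
move=> KD; apply: cvg_lim => //.
rewrite (_ : (fun n => _) = cst 1); first exact: cvg_cst.
apply/funext => n; rewrite (_ : E n @^-1` D = setT) ?probability_setT//.
by apply/seteqP; split => // w _; apply: KD.
Qed.

(** The limit law may charge a compact set that every [E n] misses, hence the
passage through its observable neighbourhoods. *)
Definition limit_content (C : set Z) : R :=
  inf [set limit_mass D | D in [set D | observable D /\ C `<=` D]].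

Lemma limit_content_ge C x :
  (forall D, observable D -> C `<=` D -> x <= limit_mass D) ->
  x <= limit_content C.
Proof.
move=> h; apply: lb_le_inf.
  by exists (limit_mass setT), setT => //; split=> //; exact: observableT.
by move=> _ [D [oD CD] <-]; exact: h.
Qed.

Lemma limit_content_le C D : observable D -> C `<=` D ->
  limit_content C <= limit_mass D.
Proof.
move=> oD CD; apply: ge_inf; last by exists D.
by exists 0 => _ [D' [oD' _] <-]; exact: limit_mass_ge0.
Qed.

Hypothesis hZ : hausdorff_space Z.
Hypothesis cK : compact K.
Hypothesis Esep : forall x y : Z, x <> y ->
  exists A B, [/\ observable A, observable B, A x, B y & A `&` B = set0].

(** Additivity on disjoint compact sets is where the observable sets have to
separate points: an observable neighbourhood of the union then splits into
disjoint observable neighbourhoods of the two pieces. *)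
Lemma limit_content_content : compact_content limit_content.
Proof.
split.
- by move=> C _; apply: limit_content_ge => D oD _; exact: limit_mass_ge0.
- move=> C C' _ _ CC'; apply: limit_content_ge => D oD C'D.
  by apply: limit_content_le => //; exact: subset_trans C'D.
- move=> C C' _ _; rewrite -lerBlDl; apply: limit_content_ge => D' oD' CD'.
  rewrite lerBlDl -lerBlDr; apply: limit_content_ge => D oD CD.
  rewrite lerBlDr; apply: le_trans (limit_massU_le oD oD').
  by apply: limit_content_le; [exact: observableU|exact: setUSS].
- move=> C C' cC cC' CC'; apply: limit_content_ge => D oD CCD.
  have [A [B [oA oB CA CB AB]]] : exists A B, [/\ observable A, observable B,
      C `<=` A, C' `<=` B & A `&` B = set0].
    apply: separate_compacts => //.
    + by move=> V [].
    + exact: observable0.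
    + exact: observableT.
    + by move=> ? ?; exact: observableU.
    + by move=> ? ?; exact: observableI.
  have oDA := observableI oD oA; have oDB := observableI oD oB.
  apply: (@le_trans _ _ (limit_mass (D `&` A) + limit_mass (D `&` B))).
    apply: lerD; apply: limit_content_le => //.
    + by move=> x Cx; split; [apply: CCD; left|exact: CA].
    + by move=> x Cx; split; [apply: CCD; right|exact: CB].
  rewrite -limit_massU//; last by rewrite setIACA AB setI0.
  apply: limit_mass_le => //; first exact: observableU.
  by move=> x [[]|[]].
Qed.

(** One half of the portmanteau theorem; the total mass is one because every
observable neighbourhood of [K] contains all the values of [E]. *)
Lemma limit_law_exists :
  exists lambda : probability (borelType Z) R,
    forall D, observable D -> (lambda D <= (limit_mass D)%:E)%E.
Proof.
have kT : inner_content limit_content setT = 1%E.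
  apply/eqP; rewrite eq_le; apply/andP; split.
    apply: inner_content_le => C _ _; rewrite lee_fin.
    rewrite -(@limit_mass_K setT)//; apply: limit_content_le => //.
    exact: observableT.
  apply: le_trans (inner_content_ge _ cK _) => //.
  rewrite lee_fin; apply: limit_content_ge => D oD KD.
  by rewrite limit_mass_K.
have [lambda [lo _]] := content_probability hZ limit_content_content kT.
exists lambda => D oD; have [oD' _] := oD.
rewrite lo//; apply: inner_content_le => C _ CD.
by rewrite lee_fin; exact: limit_content_le.
Qed.

End limit_law.

Lemma open_borel (T : ptopologicalType) (A : set T) :
  open A -> measurable (A : set (borelType T)).
Proof. by move=> oA; exact: sub_sigma_algebra. Qed.

Lemma closed_borel (T : ptopologicalType) (A : set T) :
  closed A -> measurable (A : set (borelType T)).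
Proof.
by move=> cA; rewrite -(setCK A); apply: measurableC; apply: open_borel;
  exact: closed_openC.
Qed.

Lemma borel_measurable_fun (T : ptopologicalType) (R : realType) (h : T -> R) :
  (forall a, open [set x | a < h x]) ->
  measurable_fun setT (h : borelType T -> R).
Proof.
move=> oh.
apply: (measurability _ (RGenOInfty.measurableE R)).
move=> _ [_ [a ->] <-]; rewrite setTI; apply: open_borel.
rewrite (_ : _ @^-1` _ = [set x | a < h x])//.
by apply/seteqP; split => x /=; rewrite in_itv/= andbT.
Qed.

(** The inequality of [limit_law_exists] for open sets passes to integrals of
continuous functions by layers; applied to [h] and to [1 - h], it becomes an
equality. *)
Lemma limit_law d (Omega : measurableType d) (R : realType)
    (P : probability Omega R) (Z : ptopologicalType) (K : set Z)
    (E : nat -> Omega -> Z) :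
  hausdorff_space Z -> compact K -> (forall n w, K (E n w)) ->
  (forall x y : Z, x <> y -> exists A B, [/\ observable E A, observable E B,
    A x, B y & A `&` B = set0]) ->
  exists lambda : probability (borelType Z) R,
    (forall F : set Z, closed F -> (forall n w, F (E n w)) -> lambda F = 1%E) /\
    (forall (h : Z -> R) (p : R), continuous h -> (forall z, 0 <= h z <= 1) ->
       (forall n, measurable_fun setT (h \o E n)) ->
       (fun n => \int[P]_w h (E n w)) @ \oo --> p ->
       \int[lambda]_z h z = p).
Proof.
move=> hZ cK KE Esep.
have [U [UU Uoo]] := @ultraFilterLemma nat \oo _.
have [lambda lD] := limit_law_exists P (U := U) KE hZ cK Esep.
exists lambda; split.
  move=> F cF FE.
  have oF : observable E (~` F).
    split; first exact: closed_openC.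
    move=> n; rewrite (_ : _ @^-1` _ = set0)//; apply/seteqP; split => // w /=.
    by apply; exact: FE.
  have F0 : lambda (~` F) = 0%E.
    apply/eqP; rewrite eq_le measure_ge0 andbT.
    apply: le_trans (lD _ oF) _.
    rewrite lee_fin (_ : limit_mass _ _ _ _ = 0)//.
    apply: cvg_lim => //; rewrite (_ : (fun n => _) = cst 0); first exact: cvg_cst.
    apply/funext => n; rewrite (_ : _ @^-1` _ = set0) ?measure0//.
    by apply/seteqP; split => // w /=; apply; exact: FE.
  rewrite -(setCK F) probability_setC ?F0 ?sube0//.
  by apply: measurableC; exact: closed_borel.
have upper (h : Z -> R) (p : R) : continuous h -> (forall z, 0 <= h z <= 1) ->
    (forall n, measurable_fun setT (h \o E n)) ->
    (fun n => \int[P]_w h (E n w)) @ \oo --> p -> \int[lambda]_z h z <= p.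
  move=> ch h01 mh hp.
  have oh a : open [set x | a < h x].
    rewrite (_ : [set x | _] = h @^-1` [set y | a < y])//.
    by apply: open_comp => [x _|]; [exact: ch|exact: open_gt].
  have obs a : observable E [set x | a < h x].
    split => // n; have := mh n measurableT `]a, +oo[%classic (measurable_itv _).
    rewrite setTI; congr measurable; apply/seteqP.
    by split => w /=; rewrite in_itv/= andbT.
  apply/ler_addgt0Pr => e e0.
  have [N _ /(_ N (leqnn _)) Ne] := near_infty_natSinv_lt (PosNum e0).
  have mh' : measurable_fun setT (h : borelType Z -> R) by exact: borel_measurable_fun.
  have /andP[_ /le_trans] := Rintegral_layer_bounds lambda N mh' h01; apply.
  apply: lerD; last exact: ltW.
  apply: (@le_trans _ _ (N.+1%:R^-1 *
      \sum_(i < N.+1) limit_mass P E U (layer h N i))).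
    rewrite ler_wpM2l// ?invr_ge0//; apply: ler_sum => i _.
    rewrite -lee_fin EFin_fine_measure; last exact: open_borel (oh _).
    exact: lD (obs _).
  have lhs : (fun n => N.+1%:R^-1 *
      \sum_(i < N.+1) fine (P (E n @^-1` layer h N i))) @ U -->
    N.+1%:R^-1 * \sum_(i < N.+1) limit_mass P E U (layer h N i).
    apply: cvgMr; apply: cvg_big => [|i _]; first exact: add_continuous.
    exact: cvg_limit_mass (obs _).
  have rhs : (fun n => \int[P]_w h (E n w)) @ U --> p.
    by move=> A /hp; exact: Uoo.
  apply: (ler_cvg_to lhs rhs).
  apply: nearW => n.
  have := Rintegral_layer_bounds P N (mh n) (fun w => h01 (E n w)).
  by case/andP.
move=> h p ch h01 mh hp; apply/eqP; rewrite eq_le upper//=.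
pose g z := 1 - h z.
have inth n : P.-integrable setT (EFin \o (h \o E n)).
  apply: (@bounded_integrable _ _ _ _ _ 1) => // y.
  by have /andP[h0 h1] := h01 (E n y); rewrite ger0_norm.
have int1 d' (T : measurableType d') (Q : probability T R) :
    Q.-integrable setT (EFin \o (fun=> 1 : R)).
  by apply: (@bounded_integrable _ _ _ _ _ 1) => // w; rewrite normr1.
have : \int[lambda]_z g z <= 1 - p.
  apply: upper.
  - by move=> x; apply: cvgB; [exact: cvg_cst|exact: ch].
  - by move=> z; have /andP[h0 h1] := h01 z; rewrite /g subr_ge0 h1 lerBlDr lerDl.
  - move=> n; apply: measurable_funB; [exact: measurable_cst|exact: mh].
  - rewrite (_ : (fun n => _) = (fun n => 1 - \int[P]_w h (E n w))).
      by apply: cvgB => //; exact: cvg_cst.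
    apply/funext => n; rewrite RintegralB//; [|exact: int1|exact: inth n].
    by rewrite Rintegral_cst1.
rewrite RintegralB; [|exact: measurableT| |].
- by rewrite Rintegral_cst1 lerD2l lerN2.
- exact: int1.
have mh' : measurable_fun setT (h : borelType Z -> R).
  apply: borel_measurable_fun => a.
  rewrite (_ : [set x | _] = h @^-1` [set y | a < y])//.
  by apply: open_comp => [x _|]; [exact: ch|exact: open_gt].
have hb y : `|h y| <= 1 by have /andP[h0 h1] := h01 y; rewrite ger0_norm.
exact: (bounded_integrable lambda mh' hb).
Qed.

(** * Moments of empirical frequencies *)

(** List the values of [f] first and the other indices after them: the result
is an enumeration of all indices, that is, a permutation. *)
Lemma injection_extends_to_perm k n (kn : (k <= n)%N) (f : 'I_k -> 'I_n) :
  injective f -> exists s : {perm 'I_n}, forall i, s (widen_ord kn i) = f i.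
Proof.
move=> finj; case: n => [|n] in kn f finj *.
  by exists 1%g => i; case: (f i).
pose l := codom f ++ [seq x <- enum 'I_n.+1 | x \notin codom f].
have ul : uniq l.
  rewrite cat_uniq map_inj_uniq ?enum_uniq// filter_uniq ?enum_uniq// andbT.
  by apply/hasPn => x; rewrite mem_filter => /andP[].
have sl : size l = n.+1.
  rewrite -[RHS]size_enum_ord; apply: perm_size; apply: uniq_perm => //.
    exact: enum_uniq.
  move=> x; rewrite mem_enum mem_cat mem_filter mem_enum andbT.
  by case: (x \in codom f).
have sinj : injective (fun j : 'I_n.+1 => nth ord0 l j).
  move=> i j /eqP; rewrite nth_uniq ?sl// => /eqP; exact: val_inj.
exists (perm sinj) => i; rewrite permE /= nth_cat size_codom card_ord ltn_ord.
have -> : nat_of_ord i = enum_rank i by rewrite enum_rank_ord.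
rewrite (nth_codom _ f) enum_rankK //.
Qed.

Section exchangeable_moments.
Context d d' (Omega : measurableType d) (T : measurableType d') (R : realType)
  (P : probability Omega R) (X : nat -> {RV P >-> T}).
Hypothesis exchX : exchangeable X.

Lemma measurable_joint k (J : 'I_k -> nat) (B : 'I_k -> set T) :
  (forall i, measurable (B i)) ->
  measurable [set w | forall i : 'I_k, B i (X (J i) w)].
Proof.
move=> mB; rewrite (_ : [set w | _] = \bigcap_(i in setT) (X (J i) @^-1` B i)).
  apply: fin_bigcap_measurable => // i _; rewrite -[X in measurable X]setTI.
  exact: measurable_funPT.
by apply/seteqP; split => w /= H i; [move=> _|]; exact: H.
Qed.

(** Exchangeability speaks of permutations only; the events attached to the
indices beyond [k] are taken to be the whole space. *)
Lemma exchangeable_injection k n (f : 'I_k -> 'I_n) (B : 'I_k -> set T) :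
  injective f -> (forall i, measurable (B i)) ->
  P [set w | forall i, B i (X (f i) w)] = P [set w | forall i : 'I_k, B i (X i w)].
Proof.
move=> finj mB.
have kn : (k <= n)%N by rewrite -[k]card_ord -[n]card_ord; exact: leq_card finj.
have [s sf] := injection_extends_to_perm kn finj.
pose B' (j : 'I_n) : set T := if insub (val j) is Some i then B i else setT.
have B'E i : B' (widen_ord kn i) = B i.
  rewrite /B'; case: insubP => [u _ ui|]; last by rewrite /= ltn_ord.
  by have -> : u = i by exact: val_inj.
have mB' j : measurable (B' j) by rewrite /B'; case: insubP.
have := exchX s mB'.
have -> : [set w | forall i : 'I_n, B' i (X i w)] =
    [set w | forall i : 'I_k, B i (X i w)].
  apply/seteqP; split => w /= H i.
    by have := H (widen_ord kn i); rewrite B'E.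
  rewrite /B'; case: insubP => // u _ ui; by rewrite -ui; exact: H.
move=> ->; congr (P _).
apply/seteqP; split => w /= H i; last first.
  by have := H (widen_ord kn i); rewrite B'E sf.
rewrite /B'; case: insubP => // u _ ui.
have -> : i = widen_ord kn u by exact: val_inj.
by rewrite sf; exact: H.
Qed.

Definition freq n w (B : set T) : R :=
  n.+1%:R^-1 * \sum_(i < n.+1) \1_B (X i w).

Lemma freq01 n w B : 0 <= freq n w B <= 1.
Proof.
rewrite /freq mulr_ge0 ?invr_ge0 ?sumr_ge0//=.
rewrite mulrC ler_pdivrMr ?ltr0n// mul1r.
rewrite -[leRHS]mulr1 mulr_natl -[in leRHS](card_ord n.+1) -sumr_const.
by apply: ler_sum => i _; rewrite indicE; case: (_ \in _).
Qed.

Lemma measurable_freq n B : measurable B -> measurable_fun setT (freq n ^~ B).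
Proof.
move=> mB; apply: measurable_funM => //; apply: measurable_sum => i.
by apply: measurableT_comp.
Qed.

(** Expanding the product of sums runs over all maps from the [k] factors to the
[n.+1] observations. *)
Lemma prod_freqE k n (B : 'I_k -> set T) w :
  \prod_(j < k) freq n w (B j) = (n.+1%:R ^+ k)^-1 *
    \sum_(f : {ffun 'I_k -> 'I_n.+1})
      \1_[set v | forall j, B j (X (f j) v)] w.
Proof.
rewrite big_split /= prodr_const card_ord exprVn; congr (_ * _).
rewrite bigA_distr_bigA /=; apply: eq_bigr => f _.
rewrite [RHS]indicE; have [H|H] := boolP (w \in _).
  rewrite inE /= in H.
  by rewrite big1// => j _; rewrite indicE mem_set.
have /existsNP [j nB] : ~ (forall j, B j (X (f j) w)).
  by move=> H'; move/negP: H; apply; rewrite inE.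
by rewrite (bigD1 j)//= indicE memNset// mul0r.
Qed.

Lemma Rintegral_prod_freq k n (B : 'I_k -> set T) :
  (forall j, measurable (B j)) ->
  \int[P]_w (\prod_(j < k) freq n w (B j)) = (n.+1%:R ^+ k)^-1 *
    \sum_(f : {ffun 'I_k -> 'I_n.+1})
      fine (P [set v | forall j, B j (X (f j) v)]).
Proof.
move=> mB.
have mA (f : {ffun 'I_k -> 'I_n.+1}) :
    measurable [set v | forall j, B j (X (f j) v)] by exact: measurable_joint.
under eq_Rintegral do rewrite prod_freqE.
rewrite RintegralZl//; last first.
  rewrite (_ : _ \o _ = (fun w => \sum_(f : {ffun 'I_k -> 'I_n.+1})
      (\1_[set v | forall j, B j (X (f j) v)] w)%:E)%E); last first.
    by apply/funext => w /=; rewrite sumEFin.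
  by apply: integrable_sum => // f _; exact: integrable_indic.
rewrite Rintegral_sum; last by move=> f; exact: integrable_indic.
by congr (_ * _); apply: eq_bigr => f _; rewrite Rintegral_indic.
Qed.

(** The ratio is the proportion of injective maps among all the maps from [k]
indices to [n.+1] indices. *)
Lemma cvg_ffact_ratio k :
  (fun n => (n.+1 ^_ k)%:R / n.+1%:R ^+ k : R) @ \oo --> (1 : R).
Proof.
elim: k => [|k IH].
  rewrite (_ : (fun n => _) = cst 1); first exact: cvg_cst.
  by apply/funext => n; rewrite ffactn0 expr0 divr1.
rewrite (_ : (fun n => _) = (fun n => ((n.+1 ^_ k)%:R / n.+1%:R ^+ k) *
    ((n.+1 - k)%N%:R / n.+1%:R))); last first.
  by apply/funext => n; rewrite ffactnSr natrM exprSr invfM mulrACA.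
rewrite -[X in _ --> X]mulr1; apply: cvgM => //.
apply: (@squeeze_cvgr _ _ _ _ (fun n => 1 - k%:R * harmonic n) (cst 1)).
- apply: nearW => n; apply/andP; split; last first.
    by rewrite ler_pdivrMr ?ltr0n// mul1r ler_nat leq_subr.
  rewrite ler_pdivlMr ?ltr0n// mulrBl mul1r /harmonic/= -mulrA mulVf// mulr1.
  by rewrite lerBlDr -natrD ler_nat; lia.
- rewrite -[X in _ --> X]subr0; apply: cvgB; first exact: cvg_cst.
  rewrite -(mulr0 k%:R); apply: cvgMr; exact: cvg_harmonic.
- exact: cvg_cst.
Qed.

(** Injective maps contribute exactly the limit, by exchangeability, and each of
the others is off by at most one. *)
Lemma moments_cvg k (B : 'I_k -> set T) : (forall j, measurable (B j)) ->
  (fun n => \int[P]_w (\prod_(j < k) freq n w (B j))) @ \oo -->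
    fine (P [set w | forall j : 'I_k, B j (X j w)]).
Proof.
move=> mB; set p := fine _.
have mA n (f : {ffun 'I_k -> 'I_n.+1}) :
    measurable [set v | forall j, B j (X (f j) v)] by exact: measurable_joint.
have p01 : 0 <= p <= 1 by apply: fine_prob01; exact: measurable_joint.
apply/cvgrPdist_le => /= e e0.
have /cvgrPdist_le/(_ e e0) := cvg_ffact_ratio k.
apply: filterS => n; apply: le_trans.
have N0 : 0 < n.+1%:R ^+ k :> R by rewrite exprn_gt0.
have cardf : #|{ffun 'I_k -> 'I_n.+1}| = (n.+1 ^ k)%N.
  by rewrite card_ffun !card_ord.
have -> : 1 - (n.+1 ^_ k)%:R / n.+1%:R ^+ k = (n.+1%:R ^+ k)^-1 *
    \sum_(f : {ffun 'I_k -> 'I_n.+1}) (~~ injectiveb f)%:R :> R.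
  have -> : \sum_(f : {ffun 'I_k -> 'I_n.+1}) (~~ injectiveb f)%:R =
      n.+1%:R ^+ k - (n.+1 ^_ k)%:R :> R.
    apply/eqP; rewrite eq_sym subr_eq; apply/eqP.
    have <- : #|[set f : {ffun 'I_k -> 'I_n.+1} | injectiveb f]%SET| = (n.+1 ^_ k)%N.
      by rewrite card_inj_ffuns !card_ord.
    rewrite -sum1_card natr_sum.
    rewrite [X in _ + X]big_mkcond/= -big_split/=.
    rewrite (eq_bigr (fun=> 1)) ?sumr_const ?cardT -?cardE ?cardf ?natrX//.
    by move=> f _; rewrite inE; case: (injectiveb f); rewrite ?add0r ?addr0.
  by rewrite mulrBr mulVf ?gt_eqF// mulrC.
have -> : p = (n.+1%:R ^+ k)^-1 * \sum_(f : {ffun 'I_k -> 'I_n.+1}) p.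
  by rewrite sumr_const cardT -cardE cardf -(mulr_natl p) natrX mulKf ?gt_eqF.
rewrite Rintegral_prod_freq// -mulrBr -sumrB normrM [X in X * _]ger0_norm; last first.
  by rewrite invr_ge0 ltW.
apply: le_trans (ler_norm _); rewrite ler_wpM2l ?invr_ge0 ?(ltW N0)//.
apply: le_trans (ler_norm_sum _ _ _) _; apply: ler_sum => f _.
have [/injectiveP fi|_] := boolP (injectiveb f).
  by rewrite /p (exchangeable_injection fi mB) subrr normr0.
have := fine_prob01 P (mA n f); rewrite ler_norml.
rewrite mulr1n; set q := fine (P _); move: p01 => /andP[? ?] /andP[? ?].
by apply/andP; split; lra.
Qed.

End exchangeable_moments.

(** * The A-topology and the masses of Borel sets *)

Section A_topology_facts.
Context (S : ptopologicalType) (R : realType).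

Lemma A_subbase_open (U : set (borel_prob S R)) : A_subbase U -> open U.
Proof.
move=> AU; exists [set U]; last by rewrite bigcup_set1.
by move=> _ ->; exact: (finI_from1 id AU).
Qed.

(** Induction over the open sets of the A-topology, following their construction
from the subbase. *)
Lemma A_open_ind (Q : set (set (borel_prob S R))) :
  Q setT -> (forall U V, Q U -> Q V -> Q (U `&` V)) ->
  (forall F : set (set (borel_prob S R)), F `<=` Q -> Q (\bigcup_(U in F) U)) ->
  @A_subbase S R `<=` Q -> @open (borel_prob S R) `<=` Q.
Proof.
move=> QT QI QU AQ _ [F FD <-]; apply: QU => V /FD [D DA <-].
rewrite bigcap_fset big_seq.
elim/big_ind: _ => // U UD; apply: AQ.
by have := DA _ UD; rewrite inE.
Qed.

(** The opposite of the indicator of an open set is upper semicontinuous. *)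
Lemma mass_gt_open (G : set S) (a : R) : open G ->
  open [set mu : borel_prob S R | (a%:E < mu G)%E].
Proof.
move=> oG; apply: A_subbase_open; exists (fun x => - \1_G x), (- a); split.
- move=> x b; have [Gx|Gx] := pselect (G x).
    rewrite indicE mem_set// => xb.
    apply: (filterS _ (open_nbhs_nbhs (conj oG Gx))) => y Gy.
    by rewrite indicE mem_set.
  rewrite indicE memNset// oppr0 => b0; apply: nearW => y.
  by rewrite (le_lt_trans _ b0)// oppr_le0.
- exists 1; split; first exact: num_real.
  move=> e e1 x _ /=; rewrite normrN (le_trans _ (ltW e1))// ger0_norm//.
- have mG : measurable (G : set (borelType S)) by exact: open_borel.
  have E (mu : borel_prob S R) :
      (\int[mu]_(x in [set: borelType S]) (- \1_G x)%:E = - mu G)%E.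
    under eq_integral do rewrite EFinN.
    rewrite integral_ge0N//.
    by rewrite integral_indic// setIT.
  by apply/seteqP; split => mu /=; rewrite E EFinN lteN2.
Qed.

(** Open sets are a pi-system, and the Borel sets with a measurable evaluation
form a lambda-system. *)
Lemma measurable_eval (B : set (borelType S)) : measurable B ->
  measurable_fun [set: borelType (borel_prob S R)]
    (fun mu : borel_prob S R => mu B).
Proof.
move=> mB; apply: (@dynkin_induction _ (borelType S) (@open S)
  (fun B => measurable_fun [set: borelType (borel_prob S R)]
    (fun mu : borel_prob S R => mu B))) => //.
- by move=> U V; exact: openI.
- by under eq_fun do rewrite probability_setT; exact: measurable_cst.
- move=> G oG; rewrite (_ : (fun mu => _) =
      (fun mu : borel_prob S R => (fine (mu G))%:E)); last first.
    by apply/funext => mu; rewrite EFin_fine_measure//; exact: open_borel.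
  apply/measurable_EFinP; apply: borel_measurable_fun => a.
  rewrite (_ : [set x | _] = [set mu : borel_prob S R | (a%:E < mu G)%E]).
    exact: mass_gt_open.
  apply/seteqP; split => mu /=; rewrite -lte_fin EFin_fine_measure//;
    exact: open_borel.
- move=> C mC mf; rewrite (_ : (fun mu => _) =
      (fun mu : borel_prob S R => 1 - mu C)%E); last first.
    by apply/funext => mu; rewrite probability_setC.
  by apply: emeasurable_funB => //; exact: measurable_cst.
- move=> F mF tF mf; rewrite (_ : (fun mu => _) =
      (fun mu : borel_prob S R => \sum_(n <oo) mu (F n))%E); last first.
    apply/funext => mu; rewrite measure_bigcup//.
    by apply: eq_eseriesl => n; rewrite in_setT.
  by apply: ge0_emeasurable_sum => // k _; exact: measure_ge0.
Qed.

Definition mass (B : set S) (mu : borel_prob S R) : R := fine (mu B).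

Lemma EFin_mass (B : set (borelType S)) mu : measurable B ->
  (mass B mu)%:E = mu B.
Proof. exact: EFin_fine_measure. Qed.

Lemma mass01 (B : set (borelType S)) mu : measurable B -> 0 <= mass B mu <= 1.
Proof. exact: fine_prob01. Qed.

Lemma measurable_mass (B : set (borelType S)) : measurable B ->
  measurable_fun [set: borelType (borel_prob S R)] (mass B).
Proof.
move=> mB; apply/measurable_EFinP.
have -> : EFin \o mass B = (fun mu : borel_prob S R => mu B).
  by apply/funext => mu; exact: EFin_mass.
exact: measurable_eval.
Qed.

Lemma prod_mass k (B : 'I_k -> set (borelType S)) mu :
  (forall i, measurable (B i)) ->
  (\prod_(i < k) (mu : borel_prob S R) (B i) = (\prod_(i < k) mass (B i) mu)%:E)%E.
Proof.
move=> mB; rewrite -prodEFin; apply: eq_bigr => i _; by rewrite EFin_mass.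
Qed.

Lemma measurable_prod_mass k (B : 'I_k -> set (borelType S)) :
  (forall i, measurable (B i)) ->
  measurable_fun [set: borelType (borel_prob S R)]
    (fun mu : borel_prob S R => \prod_(i < k) mass (B i) mu).
Proof. by move=> mB; apply: measurable_prod => i _; exact: measurable_mass. Qed.

Lemma prod01 k (a : 'I_k -> R) : (forall i, 0 <= a i <= 1) ->
  0 <= \prod_(i < k) a i <= 1.
Proof. by move=> a01; rewrite prodr_ge0 ?prodr_ile1//= => i _; case/andP: (a01 i). Qed.

(** Half of the equivalence between the two subbases of the A-topology: a
condition on the integral of a bounded upper semicontinuous function follows,
near a given measure, from a lower bound on finitely many masses of open sets.
These open sets are the layers of an affine image of [f]. *)
Lemma A_subbase_masses (U : set (borel_prob S R)) (mu0 : borel_prob S R) :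
  A_subbase U -> U mu0 ->
  exists N (G : 'I_N.+1 -> set S) (t : R), [/\ forall i, open (G i),
    t < \sum_(i < N.+1) mass (G i) mu0 &
    forall mu, t < \sum_(i < N.+1) mass (G i) mu -> U mu].
Proof.
move=> [f [a [uf [M0 [M0real fM0]] ->]]] /= Umu0.
pose M := Num.max M0 0 + 1.
have M_gt0 : 0 < M by rewrite /M ltr_wpDl// le_max lexx orbT.
have fM x : `|f x| <= M.
  apply: fM0 => //; rewrite /M (@le_lt_trans _ _ (Num.max M0 0))//.
    by rewrite le_max lexx.
  by rewrite ltrDl.
(* Reversing f makes it lower semicontinuous; the scaling brings it into [0, 1]. *)
pose h x := (M - f x) / (2 * M).
have h01 x : 0 <= h x <= 1.
  have := fM x; rewrite ler_norml => /andP[f1 f2].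
  rewrite /h divr_ge0 ?subr_ge0//=; last by rewrite mulr_ge0// ltW.
  by rewrite ler_pdivrMr ?mulr_gt0// mul1r; lra.
have oh t : open [set x | t < h x].
  rewrite openE => x /= tx; have /uf : f x < M - t * (2 * M).
    by move: tx; rewrite /h ltr_pdivlMr ?mulr_gt0//; lra.
  by apply: filterS => y fy; rewrite /= /h ltr_pdivlMr ?mulr_gt0//; lra.
have mh : measurable_fun setT (h : borelType S -> R) by exact: borel_measurable_fun.
have mf : measurable_fun setT (f : borelType S -> R).
  rewrite (_ : f = fun x => M - (2 * M) * h x).
    by apply: measurable_funB => //; exact: measurable_funM.
  by apply/funext => x; rewrite /h mulrC divfK ?gt_eqF ?mulr_gt0// opprB addrC subrK.
have intf (mu : borel_prob S R) :
    mu.-integrable [set: borelType S] (EFin \o f).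
  exact: (bounded_integrable mu mf fM).
pose b := (M - a) / (2 * M).
have Uh (mu : borel_prob S R) :
    ((\int[mu]_(x in [set: borelType S]) (f x)%:E < a%:E)%E <->
     b < \int[mu]_(x in [set: borelType S]) h x).
  rewrite EFin_Rintegral// lte_fin.
  have -> : \int[mu]_(x in [set: borelType S]) h x =
      (M - \int[mu]_(x in [set: borelType S]) f x) / (2 * M).
    rewrite /h RintegralZr//; last first.
      by apply: (@bounded_integrable _ _ _ _ _ (2 * M)) => [|x]; [exact: measurable_funB|
        have := fM x; rewrite !ler_norml => /andP[? ?]; apply/andP; split; lra].
    have intM : mu.-integrable [set: borelType S] (EFin \o (fun=> M)).
      by apply: (@bounded_integrable _ _ _ _ _ M) => // x; rewrite gtr0_norm.
    rewrite RintegralB; [|exact: measurableT|exact: intM|exact: intf].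
    by congr ((_ - _) / _); exact: (Rintegral_cst1 mu M).
  by rewrite /b ltr_pM2r ?invr_gt0 ?mulr_gt0// ltrD2l ltrN2.
move/Uh : Umu0 => bz.
have e0 : 0 < \int[mu0]_(x in [set: borelType S]) h x - b by rewrite subr_gt0.
have [N _ /(_ N (leqnn _)) /= Ne] := near_infty_natSinv_lt (PosNum e0).
pose s (mu : borel_prob S R) :=
  N.+1%:R^-1 * \sum_(i < N.+1) mass (layer h N i) mu.
have bs : b < s mu0.
  have /andP[_] := Rintegral_layer_bounds mu0 N mh h01; rewrite -/(s mu0).
  have Ne' : N.+1%:R^-1 < \int[mu0]_(x in [set: borelType S]) h x - b by exact: Ne.
  set J := Rintegral _ _ _ in Ne' * => Js.
  by rewrite -(ltrD2r N.+1%:R^-1); apply: lt_le_trans Js; rewrite -ltrBrDl.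
exists N, (fun i => layer h N i), (b * N.+1%:R); split.
- by move=> i; exact: oh.
- by rewrite -ltr_pdivlMr// mulrC.
move=> mu bmu; apply/Uh; apply: (@lt_le_trans _ _ (s mu)).
  by rewrite /s mulrC ltr_pdivlMr.
by have /andP[] := Rintegral_layer_bounds mu N mh h01.
Qed.

End A_topology_facts.

(** * Finitely additive set functions and the measures they induce *)

(** Set functions are indexed by all sets, not just the Borel ones, so that the
product topology of the function space can be used as it is. *)
Definition set_function (S : Type) (R : realType) : Type :=
  prod_topology (fun _ : set S => R).

HB.instance Definition _ S R := Topological.on (set_function S R).
HB.instance Definition _ (S : Type) (R : realType) :=
  isPointed.Build (set_function S R) (fun=> 0).

Section set_functions.
Context (S : ptopologicalType) (R : realType).
Local Notation Z := (set_function S R).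

Lemma set_function_hausdorff : hausdorff_space Z.
Proof. by apply: hausdorff_product => ?; exact: norm_hausdorff. Qed.

Lemma set_function_cube_compact :
  compact [set z : Z | forall B, `[0, 1 : R]%classic (z B)].
Proof.
apply: (@tychonoff (set S) (fun=> R) (fun=> `[0, 1 : R]%classic)) => B.
exact: segment_compact.
Qed.

Lemma set_value_continuous (B : set S) : continuous (fun z : Z => z B).
Proof. exact: (@proj_continuous _ (fun _ : set S => R) B). Qed.

Lemma set_value_gt_open (B : set S) a : open [set z : Z | a < z B].
Proof.
rewrite (_ : [set z | _] = (fun z : Z => z B) @^-1` [set y | a < y])//.
by apply: open_comp => [x _|]; [exact: set_value_continuous|exact: open_gt].
Qed.

(** Lower semicontinuity in [z], as a supremum of coordinates. *)
Lemma inner_content_gt_open (G : set S) (a : R) :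
  open [set z : Z | (a%:E < inner_content z G)%E].
Proof.
rewrite (_ : [set z | _] =
    \bigcup_(C in [set C | compact C /\ C `<=` G]) [set z : Z | a < z C]).
  by apply: bigcup_open => C _; exact: set_value_gt_open.
apply/seteqP; split => z /=.
  move=> /ereal_sup_gt[_ [C CG <-]]; rewrite lte_fin => aC; by exists C.
move=> [C [cC CG] aC]; apply: lt_le_trans (inner_content_ge z cC CG).
by rewrite lte_fin.
Qed.

Definition finitely_additive : set Z := [set z : Z |
  [/\ forall B : set (borelType S), measurable B -> 0 <= z B, z setT = 1 &
      forall A B : set (borelType S), measurable A -> measurable B ->
        A `&` B = set0 -> z (A `|` B) = z A + z B]].

(** Each axiom involves finitely many coordinates. *)
Lemma closed_finitely_additive : closed finitely_additive.
Proof.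
rewrite (_ : finitely_additive =
  (\bigcap_(B in (measurable : set (set (borelType S)))) [set z : Z | 0 <= z B])
  `&` ([set z : Z | z setT = 1] `&`
  \bigcap_(AB in [set AB : set (borelType S) * set (borelType S) |
      [/\ measurable AB.1, measurable AB.2 & AB.1 `&` AB.2 = set0]])
    [set z : Z | z (AB.1 `|` AB.2) - (z AB.1 + z AB.2) = 0])).
  have ceq (f : Z -> R) c : continuous f -> closed [set z | f z = c].
    move=> cf; rewrite (_ : [set z | _] = f @^-1` [set y | y = c])//.
    by apply: preimage_closed => //; exact: closed_eq.
  apply: closedI; last apply: closedI.
  - apply: closed_bigI => B _.
    rewrite (_ : [set z | _] = (fun z : Z => z B) @^-1` [set y | 0 <= y])//.
    apply: preimage_closed; last exact: closed_ge.
    by move=> z _; exact: set_value_continuous.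
  - by apply: ceq; exact: set_value_continuous.
  - apply: closed_bigI => -[A B] _; apply: ceq => z.
    have cA C := @set_value_continuous C z.
    exact: (cvgB (cA (A `|` B)) (cvgD (cA A) (cA B))).
apply/seteqP; split => z /=.
  move=> [z0 z1 zadd]; split; first by [].
  by split=> // -[A B] [/= mA mB AB]; rewrite zadd// subrr.
move=> [z0 [z1 zadd]]; split => // A B mA mB AB.
by apply/eqP; rewrite -subr_eq0; apply/eqP; exact: (zadd (A, B)).
Qed.

Lemma finitely_additive_le (z : Z) (A B : set (borelType S)) :
  finitely_additive z -> measurable A -> measurable B -> A `<=` B -> z A <= z B.
Proof.
move=> [z0 _ zadd] mA mB AB.
rewrite -(setDUK AB) zadd//; last by rewrite setDIK.
  by rewrite lerDl; apply: z0; exact: measurableD.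
exact: measurableD.
Qed.

Lemma finitely_additive01 (z : Z) (B : set (borelType S)) :
  finitely_additive z -> measurable B -> 0 <= z B <= 1.
Proof.
move=> fz mB; have [z0 z1 _] := fz; rewrite z0//= -z1.
exact: finitely_additive_le.
Qed.

Hypothesis hS : hausdorff_space S.

Lemma compact_borel (C : set S) : compact C -> measurable (C : set (borelType S)).
Proof. by move=> cC; apply: closed_borel; exact: compact_closed. Qed.

(** Compact sets of a Hausdorff space are Borel, hence in the scope of finite
additivity. *)
Lemma finitely_additive_content (z : Z) :
  finitely_additive z -> compact_content z.
Proof.
move=> fz; have [z0 z1 zadd] := fz; split.
- by move=> C /compact_borel; exact: z0.
- by move=> C C' /compact_borel mC /compact_borel mC'; exact: finitely_additive_le.
- move=> C C' /compact_borel mC /compact_borel mC'.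
  rewrite -(setDUK (@subsetUl _ C C')).
  rewrite zadd ?setDIK//; last by apply: measurableD => //; exact: measurableU.
  rewrite lerD2l; apply: finitely_additive_le => //.
    by apply: measurableD => //; exact: measurableU.
  by move=> x [[]].
- by move=> C C' /compact_borel mC /compact_borel mC' CC'; rewrite zadd.
Qed.

(** Tightness is stated through countably many open conditions, so that it is
visibly a Borel property of [z]; see [tight_total] for its meaning. *)
Definition tight : set Z := finitely_additive `&`
  \bigcap_(n in [set: nat])
    [set z : Z | ((1 - n.+1%:R^-1)%:E < inner_content z setT)%E].

Lemma measurable_tight : measurable (tight : set (borelType Z)).
Proof.
apply: measurableI; first exact: closed_borel closed_finitely_additive.
apply: bigcapT_measurable => n; exact: open_borel (inner_content_gt_open _ _).
Qed.

Lemma tight_total (z : Z) : tight z -> inner_content z setT = 1%E.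
Proof.
move=> [fz tz]; apply/eqP; rewrite eq_le; apply/andP; split.
  apply: inner_content_le => C cC _; rewrite lee_fin.
  by have /andP[] := finitely_additive01 fz (compact_borel cC).
apply/lee_addgt0Pr => e e0.
have [N _ /(_ N (leqnn _)) Ne] := near_infty_natSinv_lt (PosNum e0).
have /= := tz N I => /ltW.
rewrite EFinB leeBlDr// => /le_trans; apply; rewrite leeD2l// lee_fin; exact: ltW.
Qed.

(** On the Borel set of non-tight [z] any constant will do, and a constant keeps
[Phi] measurable. *)
Lemma radon_extension :
  {Phi : Z -> borel_prob S R |
    (forall z, tight z -> forall G : set S, open G ->
       Phi z G = inner_content z G) /\
    (forall z, tight z -> forall C : set S, compact C ->
       ((z C)%:E <= Phi z C)%E) /\
    (forall z z', ~ tight z -> ~ tight z' -> Phi z = Phi z')}.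
Proof.
pose mu0 : borel_prob S R := point.
have : forall z : Z, exists mu : borel_prob S R,
    (tight z -> (forall G : set S, open G -> mu G = inner_content z G) /\
       (forall C : set S, compact C -> ((z C)%:E <= mu C)%E)) /\
    (~ tight z -> mu = mu0).
  move=> z; have [tz|ntz] := pselect (tight z); last by exists mu0; split.
  have [mu mu_spec] := content_probability hS
    (finitely_additive_content tz.1) (tight_total tz).
  by exists mu; split.
move=> /choice[Phi Phi_spec]; exists Phi; split; last split.
- by move=> z tz; exact: ((Phi_spec z).1 tz).1.
- by move=> z tz; exact: ((Phi_spec z).1 tz).2.
- by move=> z z' /((Phi_spec z).2) -> /((Phi_spec z').2) ->.
Qed.

End set_functions.

(** * The limit law of the empirical frequencies *)

(** Coordinates are bounded only on the cube that carries the limit law;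
truncating them makes them bounded continuous functions everywhere. *)
Definition clamp {R : realType} (x : R) : R := Num.min (Num.max x 0) 1.

Section clamp.
Context (R : realType).

Lemma clamp01 (x : R) : 0 <= clamp x <= 1.
Proof. by rewrite /clamp le_min le_max lexx orbT ler01 ge_min lexx orbT. Qed.

Lemma clampK (x : R) : 0 <= x <= 1 -> clamp x = x.
Proof. by move=> /andP[x0 x1]; rewrite /clamp max_l// min_l. Qed.

Lemma continuous_clamp : continuous (@clamp R).
Proof.
move=> x.
have cm : {for x, continuous ((id : R -> R^o) \max (cst (0 : R^o)))}.
  by apply: continuous_max; [exact: cvg_id|exact: cvg_cst].
have c1 : {for x, continuous (cst (1 : R^o) : R -> R^o)} by exact: cvg_cst.
exact: (continuous_min cm c1).
Qed.

End clamp.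

Section limit_set_function.
Context (R : realType) (S : ptopologicalType) (d : measure_display)
  (Omega : measurableType d) (P : probability Omega R)
  (X : nat -> {RV P >-> borelType S}).
Hypothesis exchX : exchangeable X.
Local Notation Z := (set_function S R).

(** The value 0 at non-Borel sets makes every coordinate a random variable. *)
Definition empirical n w : Z := fun B : set (borelType S) =>
  if `[< measurable B >] then freq X n w B else 0.

Lemma empiricalE n w (B : set (borelType S)) : measurable B ->
  empirical n w B = freq X n w B.
Proof. by move=> mB; rewrite /empirical asboolT. Qed.

Lemma measurable_empirical n B : measurable_fun setT (fun w => empirical n w B).
Proof.
rewrite /empirical; case: asboolP => mB; last exact: measurable_cst.
exact: measurable_freq.
Qed.

Lemma empirical01 n w B : `[0, 1 : R]%classic (empirical n w B).
Proof.
by rewrite /= in_itv/= /empirical; case: ifP => _; rewrite ?freq01// lexx ler01.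
Qed.

Lemma empirical_additive n w : finitely_additive (empirical n w).
Proof.
split.
- by move=> B mB; have := empirical01 n w B; rewrite /= in_itv/= => /andP[].
- rewrite empiricalE; last exact: measurableT.
  rewrite /freq (eq_bigr (fun=> 1)).
    by rewrite sumr_const card_ord mulVf.
  by move=> i _; rewrite indicE in_setT.
- move=> A B mA mB AB; rewrite !empiricalE//; last exact: measurableU.
  rewrite /freq -mulrDr -big_split/=; congr (_ * _); apply: eq_bigr => i _.
  have nAB : ~~ ((X i w \in A) && (X i w \in B)).
    apply/negP => /andP[]; rewrite !inE => Ax Bx.
    by have : (A `&` B) (X i w) by []; rewrite AB.
  rewrite !indicE in_setU; move: nAB.
  by case: (X i w \in A) (X i w \in B) => [] [] //=; rewrite ?addr0 ?add0r.
Qed.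

Lemma observable_coord (B : set S) (V : set R) : open V ->
  observable empirical [set z : Z | V (z B)].
Proof.
move=> oV; split.
  rewrite (_ : [set z | _] = (fun z : Z => z B) @^-1` V)//.
  by apply: open_comp => [x _|//]; exact: set_value_continuous.
move=> n; have := measurable_empirical n B measurableT (open_measurable oV).
by rewrite setTI.
Qed.

(** Two distinct set functions differ at some coordinate, and every coordinate is
observable. *)
Lemma empirical_separates (x y : Z) : x <> y ->
  exists A B, [/\ observable empirical A, observable empirical B, A x, B y &
    A `&` B = set0].
Proof.
move=> xy; have [B xyB] : exists B, x B <> y B.
  by apply/existsNP => e; apply: xy; apply/funext.
have h (a b : R) : open [set t : R | t < (a + b) / 2] /\
    open [set t : R | (a + b) / 2 < t] by split; [exact: open_lt|exact: open_gt].
have [op1 op2] := h (x B) (y B).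
have [ltB|ltB|//] := ltgtP (x B) (y B).
  exists [set z : Z | z B < (x B + y B) / 2], [set z : Z | (x B + y B) / 2 < z B].
  split => /=; [exact: observable_coord op1|exact: observable_coord op2|lra|lra|].
  by apply/seteqP; split => // z [/=]; lra.
exists [set z : Z | (x B + y B) / 2 < z B], [set z : Z | z B < (x B + y B) / 2].
split => /=; [exact: observable_coord op2|exact: observable_coord op1|lra|lra|].
by apply/seteqP; split => // z [/=]; lra.
Qed.

(** The limit law of the empirical frequencies has the moments required of a
mixing measure, but it lives on finitely additive set functions instead of
probability measures. *)
Lemma limit_set_function : exists lambda : probability (borelType Z) R,
  lambda (@finitely_additive S R) = 1%E /\
  forall k (B : 'I_k -> set (borelType S)), (forall i, measurable (B i)) ->
    \int[lambda]_z \prod_(i < k) clamp (z (B i)) =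
    fine (P [set w | forall i : 'I_k, B i (X i w)]).
Proof.
have [lambda [lF lh]] := limit_law P (@set_function_hausdorff S R)
  (@set_function_cube_compact S R) empirical01 empirical_separates.
exists lambda; split.
  by apply: lF; [exact: closed_finitely_additive|exact: empirical_additive].
move=> k B mB.
have E n w : \prod_(i < k) clamp (empirical n w (B i)) =
    \prod_(i < k) freq X n w (B i).
  by apply: eq_bigr => i _; rewrite empiricalE// clampK// freq01.
apply: lh.
- move=> z.
  have ci i : clamp (y (B i)) @[y --> z] --> clamp (z (B i)).
    exact: (@continuous_comp Z R R (fun z : Z => z (B i)) clamp z
      (@set_value_continuous S R (B i) z) (@continuous_clamp R _)).
  exact: (@cvg_big R 'I_k *%R 1 xpredT (@mul_continuous R) Z (nbhs z)
    (index_enum 'I_k) (fun i (y : Z) => clamp (y (B i)))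
    (fun i => clamp (z (B i))) _ (fun i _ => ci i)).
- by move=> z; apply: prod01 => i; exact: clamp01.
- move=> n; rewrite (_ : _ \o _ = fun w => \prod_(i < k) freq X n w (B i)).
    by apply: measurable_prod => i _; exact: measurable_freq.
  by apply/funext => w; exact: E.
- rewrite (_ : (fun n => _) = fun n => \int[P]_w \prod_(i < k) freq X n w (B i)).
    exact: moments_cvg.
  by apply/funext => n; apply: eq_Rintegral => w _; exact: E.
Qed.

End limit_set_function.

(** * Borel measurability of the induced measure *)

Section random_measure.
Context (R : realType) (S : ptopologicalType).
Hypothesis hS : hausdorff_space S.
Local Notation Z := (set_function S R).
Variable Phi : Z -> borel_prob S R.
Hypothesis Phi_open : forall z, tight z -> forall G : set S, open G ->
  Phi z G = inner_content z G.
Hypothesis Phi_compact : forall z, tight z -> forall C : set S, compact C ->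
  ((z C)%:E <= Phi z C)%E.
Hypothesis Phi_out : forall z z', ~ tight z -> ~ tight z' -> Phi z = Phi z'.

(** By [A_subbase_masses] only finitely many masses of open sets matter, and
[Phi z] gives to an open set hardly more than [z] gives to one of its compact
subsets; the latter mass varies continuously with [z]. *)
Lemma random_measure_near (z : Z) (U : set (borel_prob S R)) : A_subbase U ->
  tight z -> U (Phi z) -> nbhs z [set z' : Z | tight z' -> U (Phi z')].
Proof.
move=> AU tz UPz.
have [N [G [t [oG tG GU]]]] := A_subbase_masses AU UPz.
pose s := \sum_(i < N.+1) mass (G i) (Phi z).
pose eps := (s - t) / 2 / N.+1%:R.
have eps0 : 0 < eps by rewrite !divr_gt0// subr_gt0.
have [C HC] : {C : 'I_N.+1 -> set S & forall i, [/\ compact (C i),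
    C i `<=` G i & mass (G i) (Phi z) - eps < z (C i)]}.
  apply: (@choice _ _ (fun (i : 'I_N.+1) C => [/\ compact C,
    C `<=` G i & mass (G i) (Phi z) - eps < z C])) => i.
  have : ((mass (G i) (Phi z) - eps)%:E < inner_content z (G i))%E.
    rewrite -Phi_open// -EFin_mass; last exact: open_borel.
    by rewrite lte_fin ltrBlDr ltrDl.
  by move=> /ereal_sup_gt[_ [K [cK KL] <-]]; rewrite lte_fin => lt; exists K.
have tC : t < \sum_(i < N.+1) z (C i).
  apply: (@lt_le_trans _ _ (\sum_(i < N.+1) (mass (G i) (Phi z) - eps))).
    rewrite sumrB sumr_const card_ord -(mulr_natr eps) divfK// -/s.
    by move: tG; rewrite -/s; lra.
  by apply: ler_sum => i _; have [_ _ /ltW] := HC i.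
have cC : \sum_(i < N.+1) z' (C i) @[z' --> z] --> \sum_(i < N.+1) z (C i).
  have ci (i : 'I_N.+1) : z' (C i) @[z' --> z] --> z (C i).
    exact: (@set_value_continuous S R (C i) z).
  have ac : continuous (fun x : R * R => x.1 + x.2) by exact: add_continuous.
  exact: (@cvg_big R 'I_N.+1 +%R 0 xpredT ac Z (nbhs z)
    (index_enum 'I_N.+1) (fun i (y : Z) => y (C i))
    (fun i => z (C i)) _ (fun i _ => ci i)).
have nb : nbhs z [set z' : Z | t < \sum_(i < N.+1) z' (C i)].
  exact: (cvgr_gt _ cC _ tC).
apply: (filterS _ nb) => z' tz' tight_z'; apply: GU; apply: (lt_le_trans tz').
apply: ler_sum => i _; have [cCi CG _] := HC i.
rewrite -lee_fin EFin_mass; last exact: open_borel.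
rewrite Phi_open//; exact: inner_content_ge.
Qed.

(** On tight set functions [Phi] is continuous, and the preimage of an arbitrary
open set is then the trace of an open set, so that the uncountable unions in
the A-topology do no harm. *)
Lemma measurable_random_measure :
  measurable_fun [set: borelType Z] (Phi : borelType Z -> borelType (borel_prob S R)).
Proof.
apply: (@measurability _ _ (borelType Z) (borelType (borel_prob S R)) setT
  (Phi : borelType Z -> borelType (borel_prob S R)) (@open (borel_prob S R))) => //.
move=> _ [U oU <-]; rewrite setTI.
have nearU (z : Z) : tight z -> U (Phi z) ->
    nbhs z [set z' : Z | tight z' -> U (Phi z')].
  move: U oU z; apply: A_open_ind.
  - by move=> z _ _; apply: (filterS _ filterT).
  - move=> U V QU QV z tz [Uz Vz].
    apply: (filterS _ (filterI (QU z tz Uz) (QV z tz Vz))) => z' [hU hV] tz'.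
    by split; [exact: hU|exact: hV].
  - move=> F FQ z tz [U FU Uz].
    apply: (filterS _ (FQ U FU z tz Uz)) => z' h tz'.
    by exists U => //; exact: h.
  - move=> U AU z; exact: random_measure_near.
have mt := @measurable_tight S R.
rewrite -(setIT (Phi @^-1` U)) -(setUCr (@tight S R)) setIUr.
apply: measurableU.
  rewrite (_ : _ `&` _ = @tight S R `&` [set z | tight z -> U (Phi z)]^°).
    by apply: measurableI => //; apply: open_borel; exact: open_interior.
  apply/seteqP; split => z /=.
    by move=> [Uz tz]; split => //; exact: nearU.
  by move=> [tz /nbhs_singleton h]; split => //; exact: h.
have [[z0 [Uz0 tz0]]|none] := pselect (exists z0, U (Phi z0) /\ ~ tight z0).
  rewrite (_ : _ `&` _ = ~` @tight S R); first exact: measurableC.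
  apply/seteqP; split => [z []//|z tz]; split => //=.
  by rewrite (Phi_out tz tz0).
rewrite (_ : _ `&` _ = set0); first exact: measurable0.
apply/seteqP; split => // z [Uz tz]; apply: none; by exists z.
Qed.

End random_measure.

(** * The mixing measure *)

(** Telescoping, changing one factor at a time. *)
Lemma dist_prod_le (R : realType) k (a b : 'I_k -> R) :
  (forall i, 0 <= a i <= 1) -> (forall i, 0 <= b i <= 1) ->
  `|\prod_(i < k) a i - \prod_(i < k) b i| <= \sum_(i < k) `|a i - b i|.
Proof.
elim: k a b => [|k IH] a b a01 b01; first by rewrite !big_ord0 subrr normr0.
rewrite !big_ord_recr /=.
set A := \prod_(i < k) _; set B := \prod_(i < k) _.
have -> : A * a ord_max - B * b ord_max =
    (A - B) * a ord_max + B * (a ord_max - b ord_max) by ring.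
apply: le_trans (ler_normD _ _) _; rewrite !normrM; apply: lerD.
  apply: le_trans (IH (fun i => a (widen_ord (leqnSn k) i))
    (fun i => b (widen_ord (leqnSn k) i)) _ _) => //.
  rewrite -[leRHS]mulr1 ler_wpM2l//.
  by have /andP[? ?] := a01 ord_max; rewrite ger0_norm.
rewrite -[leRHS]mul1r ler_wpM2r//.
have /andP[? ?] : 0 <= B <= 1 by apply: prod01 => i; exact: b01.
by rewrite ger0_norm.
Qed.

Section existence.
Context (R : realType) (S : ptopologicalType) (hS : hausdorff_space S)
  (d : measure_display) (Omega : measurableType d) (P : probability Omega R)
  (X : nat -> {RV P >-> borelType S}).
Hypothesis radonX : radon (distribution P (X 0%N)).
Local Notation Z := (set_function S R).
Variable lambda : probability (borelType Z) R.
Hypothesis lambda_fa : lambda (@finitely_additive S R) = 1%E.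
Let m (B : set S) := fine (P (X 0%N @^-1` B)).
Hypothesis lambda_mean : forall B : set (borelType S), measurable B ->
  \int[lambda]_z clamp (z B) = m B.

Let measurable_X0 (B : set (borelType S)) : measurable B ->
  measurable (X 0%N @^-1` B).
Proof. by move=> mB; rewrite -[X in measurable X]setTI; exact: measurable_funPT. Qed.

Lemma marginal_inner (B : set (borelType S)) e : measurable B -> 0 < e ->
  exists K : set S, [/\ compact K, K `<=` B & m B - e < m K].
Proof.
move=> mB e0; have rB := radonX mB.
have fB : distribution P (X 0%N) B \is a fin_num by exact: fin_num_measure.
have fs := fB; rewrite rB in fs.
have [_ [K [KB cK] <-] lt] := ub_ereal_sup_adherent e0 fs.
exists K; split=> //; rewrite -rB in lt.
rewrite -lte_fin EFinB /m !EFin_fine_measure//; apply: measurable_X0 => //.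
exact: compact_borel.
Qed.

Lemma integrable_clamp_coord (B : set S) :
  lambda.-integrable setT (EFin \o (fun z : Z => clamp (z B))).
Proof.
have mc : measurable_fun setT ((fun z => clamp (z B)) : borelType Z -> R).
  apply: borel_measurable_fun => a.
  rewrite (_ : [set x | _] = (fun z : Z => clamp (z B)) @^-1` [set y | a < y])//.
  apply: open_comp => [z _|]; last exact: open_gt.
  exact: (@continuous_comp Z R R (fun z : Z => z B) clamp z
    (@set_value_continuous S R B z) (@continuous_clamp R _)).
apply: (bounded_integrable lambda mc (c := 1)) => z.
by have /andP[? ?] := clamp01 (z B); rewrite ger0_norm.
Qed.

(** A compact set that nearly carries the law of [X 0] has mean [lambda]-mass
nearly one, so Markov's inequality bounds the measure of the set functions
whose mass on all compact sets stays below 1 - 1/(n+1). *)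
Lemma lambda_tight : lambda (@tight S R) = 1%E.
Proof.
pose A n := [set z : Z | ((1 - n.+1%:R^-1)%:E < inner_content z setT)%E].
have mA n : measurable (A n : set (borelType Z)).
  exact: open_borel (inner_content_gt_open _ _).
have mF : measurable (@finitely_additive S R : set (borelType Z)).
  exact: closed_borel (@closed_finitely_additive S R).
have mCA n : measurable (~` A n : set (borelType Z)) by exact: measurableC.
have A0 n : lambda (~` A n) = 0%E.
  have : fine (lambda (~` A n)) <= 0.
    rewrite -(pmulr_rle0 _ (_ : 0 < n.+1%:R^-1)); last by rewrite invr_gt0.
    apply/ler_addgt0Pr => e e0; rewrite add0r.
    have [K [cK _ mK]] := marginal_inner measurableT e0.
    have mT : m setT = 1 by rewrite /m preimage_setT probability_setT.
    have mBK := compact_borel hS cK.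
    apply: (@le_trans _ _ (1 - m K)); last by rewrite mT in mK; lra.
    have int1 : lambda.-integrable setT (EFin \o (fun=> 1 : R)).
      by apply: (@bounded_integrable _ _ _ _ _ 1) => // w; rewrite normr1.
    have intA : lambda.-integrable setT (EFin \o \1_(~` A n)).
      exact: integrable_indic.
    have intK := integrable_clamp_coord K.
    have -> : 1 - m K = \int[lambda]_z (1 - clamp (z K)).
      by rewrite RintegralB// (Rintegral_cst1 lambda 1) (lambda_mean mBK).
    rewrite -Rintegral_indic// -RintegralZl//.
    apply: (le_Rintegral_as mF lambda_fa).
    - rewrite (_ : _ \o _ =
        (fun x => (n.+1%:R^-1 : R)%:E * (\1_(~` A n) x)%:E)%E)//.
      exact: integrableZl.
    - by apply: integrable_EFinB.
    move=> z fz; rewrite clampK; last exact: finitely_additive01.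
    have /andP[zK0 zK1] := finitely_additive01 fz mBK.
    rewrite indicE; have [|_] := boolP (z \in _); last by rewrite mulr0 subr_ge0.
    rewrite inE mulr1 /A/= => /negP; rewrite -leNgt => zn.
    have := le_trans (inner_content_ge z cK (@subsetT _ K)) zn.
    rewrite lee_fin => h; by rewrite lerBrDr addrC -lerBrDr.
  move=> le0; apply/eqP; rewrite eq_le measure_ge0 andbT.
  by rewrite -EFin_fine_measure.
have tE : ~` @tight S R = ~` @finitely_additive S R `|` \bigcup_n ~` A n.
  by rewrite /tight setCI setC_bigcap.
have F0 : lambda (~` @finitely_additive S R) = 0%E.
  by rewrite probability_setC// lambda_fa subee.
have mt := @measurable_tight S R.
have : lambda.-negligible (~` @tight S R).
  rewrite tE; apply: negligibleU.
    by apply/negligibleP => //; exact: measurableC.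
  by apply: negligible_bigcup => n; apply/negligibleP; [exact: mCA|exact: A0].
move/negligibleP => /(_ (measurableC mt)) t0.
by rewrite -(setCK (@tight S R)) probability_setC ?t0 ?sube0//; exact: measurableC.
Qed.

Variable Phi : Z -> borel_prob S R.
Hypothesis Phi_compact : forall z, tight z -> forall C : set S, compact C ->
  ((z C)%:E <= Phi z C)%E.
Hypothesis Phi_measurable :
  measurable_fun [set: borelType Z] (Phi : borelType Z -> borelType (borel_prob S R)).

Lemma measurable_mass_Phi (B : set (borelType S)) : measurable B ->
  measurable_fun [set: borelType Z] (fun z => mass B (Phi z)).
Proof.
move=> mB; exact: (measurableT_comp (measurable_mass mB) Phi_measurable).
Qed.

Lemma integrable_mass_Phi (B : set (borelType S)) : measurable B ->
  lambda.-integrable setT (EFin \o (fun z => mass B (Phi z))).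
Proof.
move=> mB; apply: (bounded_integrable lambda (measurable_mass_Phi mB) (c := 1)).
by move=> z; have /andP[? ?] := mass01 (Phi z) mB; rewrite ger0_norm.
Qed.

Lemma clamp_le_mass (K : set S) (B : set (borelType S)) z : compact K ->
  measurable B -> K `<=` B -> tight z -> clamp (z K) <= mass B (Phi z).
Proof.
move=> cK mB KB tz; have mK := compact_borel hS cK.
rewrite clampK; last by apply: finitely_additive01 => //; exact: tz.1.
rewrite -lee_fin EFin_mass//; apply: le_trans (Phi_compact tz cK) _.
by apply: le_measure => //; rewrite inE.
Qed.

(** On a compact subset of [B] the mass can only increase from [z] to [Phi z], and
such subsets exhaust the mean of [B]. *)
Lemma mean_mass_ge (B : set (borelType S)) : measurable B ->
  m B <= \int[lambda]_z mass B (Phi z).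
Proof.
move=> mB; apply/ler_addgt0Pr => e e0.
have [K [cK KB mK]] := marginal_inner mB e0.
rewrite -lerBlDr; apply: le_trans (ltW mK) _.
rewrite -(lambda_mean (compact_borel hS cK)).
apply: (le_Rintegral_as (@measurable_tight S R) lambda_tight).
- exact: integrable_clamp_coord.
- exact: integrable_mass_Phi.
- by move=> z; exact: clamp_le_mass.
Qed.

(** The complement of [B] satisfies the same lower bound, and both means add up
to one. *)
Lemma mean_mass (B : set (borelType S)) : measurable B ->
  \int[lambda]_z mass B (Phi z) = m B.
Proof.
move=> mB; apply/eqP; rewrite eq_le mean_mass_ge// andbT.
have mC := measurableC mB.
have := mean_mass_ge mC.
have -> : m (~` B) = 1 - m B.
  rewrite /m preimage_setC probability_setC ?fineB ?fin_num_measure//;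
    exact: measurable_X0.
have -> : \int[lambda]_z mass (~` B) (Phi z) = 1 - \int[lambda]_z mass B (Phi z).
  rewrite -[X in X - _](Rintegral_cst1 lambda 1) -RintegralB//.
  - apply: eq_Rintegral => z _; rewrite /mass probability_setC// fineB//.
    by rewrite fin_num_measure.
  - by apply: (@bounded_integrable _ _ _ _ _ 1) => // w; rewrite normr1.
  - exact: integrable_mass_Phi.
by rewrite lerD2l lerN2.
Qed.

Lemma integrable_dist (B : set (borelType S)) : measurable B ->
  lambda.-integrable setT
    (EFin \o (fun z : Z => `|mass B (Phi z) - clamp (z B)|)).
Proof.
move=> mB; apply: (@integrable_norm _ _ _ lambda setT
  (fun z : Z => mass B (Phi z) - clamp (z B))).
by apply: integrable_EFinB; [exact: integrable_mass_Phi|exact: integrable_clamp_coord].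
Qed.

(** Both [Phi z B] and [z B] dominate [z K] for a compact [K] included in [B], and
their means exceed that of [z K] by little. *)
Lemma mean_dist_mass (B : set (borelType S)) : measurable B ->
  \int[lambda]_z `|mass B (Phi z) - clamp (z B)| <= 0.
Proof.
move=> mB; apply/ler_addgt0Pr => e e0; rewrite add0r.
have e2 : 0 < e / 2 by rewrite divr_gt0.
have [K [cK KB mK]] := marginal_inner mB e2.
have mBK := compact_borel hS cK.
have iE := integrable_mass_Phi mB.
have iB := integrable_clamp_coord B.
have iK := integrable_clamp_coord K.
have iEK : lambda.-integrable setT
    (EFin \o (fun z : Z => mass B (Phi z) - clamp (z K))) by exact: integrable_EFinB.
have iBK : lambda.-integrable setT
    (EFin \o (fun z : Z => clamp (z B) - clamp (z K))) by exact: integrable_EFinB.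
apply: (@le_trans _ _ (\int[lambda]_z
    ((mass B (Phi z) - clamp (z K)) + (clamp (z B) - clamp (z K))))).
  apply: (le_Rintegral_as (@measurable_tight S R) lambda_tight).
  - exact: integrable_dist.
  - exact: integrable_EFinD.
  move=> z tz; have h1 := clamp_le_mass cK mB KB tz.
  have h2 : clamp (z K) <= clamp (z B).
    rewrite !clampK; try by apply: finitely_additive01 => //; exact: tz.1.
    by apply: finitely_additive_le => //; exact: tz.1.
  by rewrite ler_norml; apply/andP; split; lra.
rewrite RintegralD// !RintegralB//.
by rewrite (mean_mass mB) (lambda_mean mB) (lambda_mean mBK); lra.
Qed.

Lemma mean_prod_mass k (B : 'I_k -> set (borelType S)) :
  (forall i, measurable (B i)) ->
  \int[lambda]_z \prod_(i < k) mass (B i) (Phi z) =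
  \int[lambda]_z \prod_(i < k) clamp (z (B i)).
Proof.
move=> mB.
have iE : lambda.-integrable setT
    (EFin \o (fun z => \prod_(i < k) mass (B i) (Phi z))).
  apply: (bounded_integrable lambda (c := 1)).
    by apply: measurable_prod => i _; exact: measurable_mass_Phi.
  move=> z; have /andP[? ?] : 0 <= \prod_(i < k) mass (B i) (Phi z) <= 1.
    by apply: prod01 => i; exact: mass01.
  by rewrite ger0_norm.
have iC : lambda.-integrable setT
    (EFin \o (fun z : Z => \prod_(i < k) clamp (z (B i)))).
  apply: (bounded_integrable lambda (c := 1)).
    apply: measurable_prod => i _; apply/measurable_EFinP.
    exact: measurable_int (integrable_clamp_coord (B i)).
  move=> z; have /andP[? ?] : 0 <= \prod_(i < k) clamp (z (B i)) <= 1.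
    by apply: prod01 => i; exact: clamp01.
  by rewrite ger0_norm.
apply/eqP; rewrite -subr_eq0 -normr_le0 -RintegralB//.
apply: le_trans (le_normr_Rintegral _ _) _ => //; first exact: integrable_EFinB.
apply: (@le_trans _ _ (\int[lambda]_z
    \sum_(i < k) `|mass (B i) (Phi z) - clamp (z (B i))|)).
  apply: le_Rintegral => //.
  - by apply: integrable_norm; exact: integrable_EFinB.
  - rewrite (_ : _ \o _ = (fun z : Z =>
        \sum_(i < k) `|mass (B i) (Phi z) - clamp (z (B i))|%:E)%E).
      by apply: integrable_sum => // i _; exact: integrable_dist.
    by apply/funext => z /=; rewrite sumEFin.
  - move=> z _; apply: dist_prod_le => i; first exact: mass01.
    exact: clamp01.
rewrite Rintegral_sum; last by move=> i; exact: integrable_dist.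
by apply: sumr_le0 => i _; exact: mean_dist_mass.
Qed.

End existence.

Lemma mixture_exists (R : realType) (S : ptopologicalType)
    (hS : hausdorff_space S)
    (d : measure_display) (Omega : measurableType d) (P : probability Omega R)
    (X : nat -> {RV P >-> borelType S})
    (exchX : exchangeable X)
    (radonX : radon (distribution P (X 0%N))) :
  exists Q : probability (borelType (borel_prob S R)) R, mixture_of_iid X Q.
Proof.
have [lambda [lF lmom]] := limit_set_function exchX.
have [Phi [Phi_open [Phi_compact Phi_out]]] := radon_extension R hS.
have mPhi := measurable_random_measure Phi_open Phi_out.
pose PhiM : {mfun borelType (set_function S R) >-> borelType (borel_prob S R)} :=
  HB.pack (Phi : borelType (set_function S R) -> borelType (borel_prob S R))
  (isMeasurableFun.Build _ _ _ _ _ mPhi).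
have lmean (B : set (borelType S)) : measurable B ->
    \int[lambda]_z clamp (z B) = fine (P (X 0%N @^-1` B)).
  move=> mB; have := lmom 1%N (fun=> B) (fun=> mB).
  under eq_Rintegral do rewrite big_ord_recl big_ord0 mulr1.
  move=> ->; congr (fine (P _)); apply/seteqP; split => w /=.
    by move=> /(_ ord0).
  by move=> Bw i; rewrite ord1.
exists (distribution lambda PhiM) => k B mB.
under eq_integral do rewrite prod_mass//.
pose g (z : set_function S R) := \prod_(i < k) mass (B i) (Phi z).
have -> : (\int[distribution lambda PhiM]_mu (\prod_(i < k) mass (B i) mu)%:E =
    \int[lambda]_z (g z)%:E)%E.
  apply: ge0_integral_distribution.
    by apply/measurable_EFinP; exact: measurable_prod_mass.
  by move=> mu; rewrite lee_fin; apply: prodr_ge0 => i _; rewrite fine_ge0.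
have mg : measurable_fun [set: borelType (set_function S R)] g.
  by apply: measurable_prod => i _; exact: (measurable_mass_Phi mPhi (mB i)).
have g1 z : `|g z| <= 1.
  have /andP[? ?] : 0 <= g z <= 1 by apply: prod01 => i; exact: mass01.
  by rewrite ger0_norm.
rewrite EFin_Rintegral; last exact: (bounded_integrable lambda mg g1).
rewrite (mean_prod_mass hS radonX lF lmean Phi_compact mPhi mB) lmom//.
by rewrite EFin_fine_measure//; exact: (measurable_joint X (fun i : 'I_k => i) mB).
Qed.

(** * The weighted moment problem on the unit interval *)

Lemma bernoulli_lower (R : realFieldType) (y : R) N : 0 <= y <= 1 ->
  1 - N%:R * y <= (1 - y) ^+ N.
Proof.
move=> /andP[y0 y1]; elim: N => [|N IH]; first by rewrite mul0r subr0 expr0.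
rewrite exprS -natr1; apply: (@le_trans _ _ ((1 - y) * (1 - N%:R * y))).
  have ? : 0 <= N%:R * y * y by rewrite !mulr_ge0.
  lra.
by rewrite ler_wpM2l// subr_ge0.
Qed.

(** The usable form of (1 - y)^N <= 1 / (1 + N y). *)
Lemma bernoulli_upper (R : realFieldType) (y : R) N : 0 <= y <= 1 ->
  (1 - y) ^+ N * (N%:R * y) <= 1.
Proof.
move=> /andP[y0 y1].
have pN k : 0 <= (1 - y) ^+ k by rewrite exprn_ge0// subr_ge0.
suff : (1 - y) ^+ N * (1 + N%:R * y) <= 1.
  by have := pN N; rewrite mulrDr mulr1; lra.
elim: N => [|N IH]; first by rewrite expr0 mul0r addr0 mulr1.
apply: le_trans IH; rewrite exprSr -mulrA ler_wpM2l// -natr1.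
have ? : 0 <= N%:R * y * y by rewrite !mulr_ge0.
have ? : 0 <= y * y by rewrite mulr_ge0.
lra.
Qed.

(** On the unit interval, the polynomials (1 - x^n)^N with N close to t^(-n)
approach the indicator of the x below t, uniformly away from the threshold t. *)
Lemma step_polynomial (R : realType) (a b e : R) : 0 <= a -> a < b -> 0 < e ->
  exists p : {poly R}, [/\ forall x, 0 <= x <= 1 -> 0 <= p.[x] <= 1,
    forall x, 0 <= x <= 1 -> x <= a -> 1 - e <= p.[x] &
    forall x, 0 <= x <= 1 -> b <= x -> p.[x] <= e].
Proof.
move=> a0 ab e0; have [b1|b1] := ltP 1 b.
  exists 1; split=> x x01; rewrite hornerE ?lexx ?ler01//.
    by move=> _; rewrite gerBl ltW.
  by move=> bx; lra.
(* Any threshold strictly between a and b works. *)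
pose t := (a + b) / 2.
have t0 : 0 < t by rewrite /t; lra.
have at' : a < t by rewrite /t; lra.
have tb : t < b by rewrite /t; lra.
have b0 : 0 < b by lra.
have cvg0 (r : R) : 0 <= r -> r < 1 -> \forall n \near \oo, r ^+ n <= e / 2.
  move=> r0 r1; have /cvg_expr/cvgr_le h : `|r| < 1 by rewrite ger0_norm.
  by apply: h; rewrite divr_gt0.
have r1 : a / t < 1 by rewrite ltr_pdivrMr// mul1r.
have s1 : t / b < 1 by rewrite ltr_pdivrMr// mul1r.
have a1 : a < 1 by lra.
have r0 : 0 <= a / t by rewrite divr_ge0// ltW.
have s0 : 0 <= t / b by rewrite divr_ge0// ltW.
have [n [nr na ns]] : exists n, [/\ (a / t) ^+ n <= e / 2, a ^+ n <= e / 2 &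
    (t / b) ^+ n <= e / 2].
  have [k1 _ h1] := cvg0 _ r0 r1; have [k2 _ h2] := cvg0 _ a0 a1.
  have [k3 _ h3] := cvg0 _ s0 s1.
  exists (maxn k1 (maxn k2 k3)); split.
  - by apply: h1 => /=; rewrite leq_maxl.
  - by apply: h2 => /=; rewrite leq_max leq_maxl orbT.
  - by apply: h3 => /=; rewrite !leq_max leqnn !orbT.
(* With N of order t^(-n), the product N x^n is of order (x / t)^n. *)
pose N := (Num.truncn (t ^- n)).+1.
have tn0 : 0 <= t ^- n by rewrite invr_ge0 exprn_ge0// ltW.
have /andP[N1 N2] : t ^- n <= N%:R <= t ^- n + 1.
  have /andP[h1 h2] := truncn_itv tn0.
  by rewrite (ltW h2)/= /N -natr1 lerD2r.
have xn01 (x : R) : 0 <= x <= 1 -> 0 <= x ^+ n <= 1.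
  by move=> /andP[x0 x1]; rewrite exprn_ge0// exprn_ile1.
exists ((1 - 'X^n) ^+ N); split => x x01; rewrite !hornerE.
- have /andP[? ?] := xn01 x x01.
  by rewrite exprn_ge0 ?subr_ge0//= exprn_ile1// ?subr_ge0// gerBl.
- move=> xa; apply: le_trans (bernoulli_lower _ (xn01 x x01)).
  rewrite lerD2l lerN2.
  have /andP[x0 x1] := x01.
  apply: (@le_trans _ _ ((t ^- n + 1) * a ^+ n)).
    by rewrite ler_pM// ?exprn_ge0// lerXn2r.
  rewrite mulrDl mul1r mulrC -expr_div_n; lra.
- move=> bx; have /andP[x0 x1] := x01.
  have xn0 : 0 < x ^+ n by rewrite exprn_gt0//; lra.
  apply: (@le_trans _ _ ((t / b) ^+ n)); last lra.
  have := bernoulli_upper N (xn01 x x01).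
  have Nx0 : 0 < N%:R * x ^+ n by rewrite mulr_gt0// ltr0n.
  rewrite -ler_pdivlMr// mul1r => /le_trans; apply.
  have tb0 : 0 < (t / b) ^+ n by rewrite exprn_gt0// divr_gt0.
  rewrite -[leRHS]invrK lef_pV2 ?posrE ?invr_gt0//.
  rewrite expr_div_n invf_div mulrC.
  by rewrite ler_pM ?exprn_ge0 ?(ltW b0)// lerXn2r ?nnegrE//; lra.
Qed.

Section moments.
Context d (Y : measurableType d) (R : realType).
Implicit Types (Q : probability Y R) (h x : Y -> R).

Definition unit_valued (h : Y -> R) :=
  measurable_fun setT h /\ forall y, 0 <= h y <= 1.

Lemma unit_valued_integrable Q h : unit_valued h -> Q.-integrable setT (EFin \o h).
Proof.
move=> [mh h01]; apply: (bounded_integrable Q mh (c := 1)) => y.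
by have /andP[? ?] := h01 y; rewrite ger0_norm.
Qed.

Lemma unit_valuedM h x : unit_valued h -> unit_valued x ->
  unit_valued (fun y => h y * x y).
Proof.
move=> [mh h01] [mx x01]; split; first exact: measurable_funM.
move=> y; have /andP[? ?] := h01 y; have /andP[? ?] := x01 y.
by rewrite mulr_ge0//= mulr_ile1.
Qed.

Lemma unit_valuedX x n : unit_valued x -> unit_valued (fun y => x y ^+ n).
Proof.
move=> [mx x01]; split; first exact: measurable_funX.
by move=> y; have /andP[? ?] := x01 y; rewrite exprn_ge0//= exprn_ile1.
Qed.

Definition sublevel x (a : R) : set Y := [set y | x y <= a].

Lemma measurable_sublevel x a : measurable_fun setT x -> measurable (sublevel x a).
Proof.
move=> mx; have := mx measurableT `]-oo, a]%classic (measurable_itv _).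
by rewrite setTI; congr measurable; apply/seteqP; split => y /=; rewrite in_itv.
Qed.

Lemma unit_valued_sublevel x a : measurable_fun setT x ->
  unit_valued (\1_(sublevel x a) : Y -> R).
Proof.
move=> mx; split; first by apply: measurable_indic; exact: measurable_sublevel.
by move=> y; rewrite indicE; case: (_ \in _); rewrite ?lexx ler01.
Qed.

Variables (Q1 Q2 : probability Y R).

Lemma polynomial_agree h x (p : {poly R}) : unit_valued h -> unit_valued x ->
  (forall n, \int[Q1]_y (h y * x y ^+ n) = \int[Q2]_y (h y * x y ^+ n)) ->
  \int[Q1]_y (h y * p.[x y]) = \int[Q2]_y (h y * p.[x y]).
Proof.
move=> uh ux agree.
have E (Q : probability Y R) : \int[Q]_y (h y * p.[x y]) =
    \sum_(i < size p) p`_i * \int[Q]_y (h y * x y ^+ i).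
  have ii i : Q.-integrable setT (EFin \o (fun y => h y * x y ^+ i)).
    by apply: unit_valued_integrable; apply: unit_valuedM => //; exact: unit_valuedX.
  under eq_Rintegral do rewrite horner_coef mulr_sumr.
  rewrite Rintegral_sum.
    apply: eq_bigr => i _; rewrite -RintegralZl//.
    by apply: eq_Rintegral => y _; rewrite mulrCA.
  move=> i; rewrite (_ : _ \o _ = (fun y => (p`_i)%:E * (h y * x y ^+ i)%:E)%E).
    exact: (@integrableZl _ _ _ Q setT measurableT p`_i
      (fun y => (h y * x y ^+ i)%:E) (ii i)).
  by apply/funext => y /=; rewrite mulrCA EFinM.
by rewrite !E; apply: eq_bigr => i _; rewrite agree.
Qed.

(** A step polynomial between the two thresholds is squeezed between the two
indicators, up to an arbitrarily small error. *)
Lemma sublevel_le h x a b : unit_valued h -> unit_valued x ->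
  (forall n, \int[Q1]_y (h y * x y ^+ n) = \int[Q2]_y (h y * x y ^+ n)) ->
  a < b ->
  \int[Q1]_y (h y * \1_(sublevel x a) y) <=
  \int[Q2]_y (h y * \1_(sublevel x b) y).
Proof.
move=> uh ux agree ab; have [mh h01] := uh; have [mx x01] := ux.
have uhs c : unit_valued (fun y => h y * \1_(sublevel x c) y).
  by apply: unit_valuedM => //; exact: unit_valued_sublevel.
have [a0|a0] := ltP a 0.
  rewrite (_ : \int[Q1]_y _ = 0).
    by apply: Rintegral_ge0 => y _; have /andP[] := (uhs b).2 y.
  rewrite -[RHS](Rintegral_cst1 Q1 0); apply: eq_Rintegral => y _.
  rewrite indicE memNset ?mulr0// /sublevel/= => xa.
  by have /andP[] := x01 y; lra.
apply/ler_addgt0Pr => e e0; have e2 : 0 < e / 2 by rewrite divr_gt0.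
have [p [p01 pa pb]] := step_polynomial a0 ab e2.
have up : unit_valued (fun y => p.[x y]).
  split; last by move=> y; exact: p01.
  rewrite (_ : (fun y => _) = fun y => \sum_(i < size p) p`_i * x y ^+ i).
    apply: measurable_sum => i; apply: measurable_funM => //.
    exact: measurable_funX.
  by apply/funext => y; rewrite horner_coef.
have uhp := unit_valuedM uh up.
have ic (Q : probability Y R) : Q.-integrable setT (EFin \o (fun=> e / 2)).
  by apply: (@bounded_integrable _ _ _ _ _ (e / 2)) => // y; rewrite gtr0_norm.
have ae (Q : probability Y R) f : unit_valued f ->
    Q.-integrable setT (EFin \o (fun y => f y + e / 2)) /\
    \int[Q]_y (f y + e / 2) = \int[Q]_y f y + e / 2.
  move=> uf; have fi := unit_valued_integrable Q uf; split.
    exact: integrable_EFinD.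
  rewrite RintegralD; [|exact: measurableT|exact: fi|exact: ic].
  by rewrite (Rintegral_cst1 Q).
apply: (@le_trans _ _ (\int[Q1]_y (h y * p.[x y] + e / 2))).
  apply: le_Rintegral => //; [exact: unit_valued_integrable|exact: (ae Q1 _ uhp).1|].
  move=> y _; have /andP[h0 h1] := h01 y; have /andP[p0 p1] := p01 _ (x01 y).
  rewrite indicE; have [|_] := boolP (y \in _).
    rewrite inE => /(pa _ (x01 y)) pe.
    have : h y * (1 - p.[x y]) <= 1 * (e / 2) by apply: ler_pM => //; lra.
    by rewrite mulrBr mulr1; lra.
  by rewrite mulr0 addr_ge0 ?mulr_ge0// ltW.
rewrite (ae Q1 _ uhp).2 (polynomial_agree p uh ux agree).
apply: (@le_trans _ _ (\int[Q2]_y (h y * \1_(sublevel x b) y + e / 2) + e / 2)).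
  rewrite lerD2r; apply: le_Rintegral => //.
  - exact: unit_valued_integrable.
  - exact: (ae Q2 _ (uhs b)).1.
  move=> y _; have /andP[h0 h1] := h01 y; have /andP[p0 p1] := p01 _ (x01 y).
  rewrite indicE; have [_|] := boolP (y \in _).
    have : h y * p.[x y] <= h y * 1 by rewrite ler_wpM2l.
    by rewrite mulr1; lra.
  rewrite notin_setE /sublevel/= => /negP; rewrite -ltNge => bx.
  have := pb _ (x01 y) (ltW bx) => pe.
  have : h y * p.[x y] <= 1 * (e / 2) by apply: ler_pM.
  by rewrite mulr0; lra.
by rewrite (ae Q2 _ (uhs b)).2; lra.
Qed.

(** Let the larger threshold of [sublevel_le] decrease to [a]. *)
Lemma sublevel_agree_le h x a : unit_valued h -> unit_valued x ->
  (forall n, \int[Q1]_y (h y * x y ^+ n) = \int[Q2]_y (h y * x y ^+ n)) ->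
  \int[Q1]_y (h y * \1_(sublevel x a) y) <=
  \int[Q2]_y (h y * \1_(sublevel x a) y).
Proof.
move=> uh ux agree; have [mh h01] := uh; have [mx x01] := ux.
have uhs c : unit_valued (fun y => h y * \1_(sublevel x c) y).
  by apply: unit_valuedM => //; exact: unit_valued_sublevel.
pose D n := sublevel x (a + n.+1%:R^-1) `\` sublevel x a.
have mD n : measurable (D n) by apply: measurableD; exact: measurable_sublevel.
have bnd n : \int[Q1]_y (h y * \1_(sublevel x a) y) <=
    \int[Q2]_y (h y * \1_(sublevel x a) y) + fine (Q2 (D n)).
  have an : a < a + n.+1%:R^-1 by rewrite ltrDl invr_gt0.
  apply: le_trans (sublevel_le uh ux agree an) _.
  have iD : Q2.-integrable setT (EFin \o \1_(D n)) by exact: integrable_indic.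
  have ia := unit_valued_integrable Q2 (uhs a).
  rewrite -Rintegral_indic// -RintegralD//.
  apply: le_Rintegral => //; [exact: unit_valued_integrable|exact: integrable_EFinD|].
  move=> y _; have /andP[h0 h1] := h01 y.
  rewrite !indicE /D in_setD.
  case: (y \in sublevel x a); case: (y \in sublevel x _) => /=;
    rewrite ?mulr1 ?mulr0; lra.
have D0 : \bigcap_n D n = set0.
  apply/seteqP; split => // y Dy.
  have [_ /negP] := Dy 0%N I; rewrite -ltNge => ay.
  have e0 : 0 < x y - a by rewrite subr_gt0.
  have [N _ /(_ N (leqnn _)) Ne] := near_infty_natSinv_lt (PosNum e0).
  have [] := Dy N I; rewrite /sublevel/= => xN _.
  have Ne' : N.+1%:R^-1 < x y - a by exact: Ne.
  have : x y - a <= N.+1%:R^-1 by rewrite lerBlDl.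
  by rewrite leNgt Ne'.
have cvgD0 : (fun n => fine (Q2 (D n))) @ \oo --> (0 : R).
  apply: fine_cvg.
  rewrite (_ : 0%:E = Q2 (\bigcap_n D n)); last by rewrite D0 measure0.
  apply: nonincreasing_cvg_mu => //.
  - by rewrite -ge0_fin_numE ?fin_num_measure.
  - exact: bigcapT_measurable.
  move=> i j ij; apply/subsetPset => y [xy nxy]; split => //.
  rewrite /sublevel/= in xy *; apply: le_trans xy _.
  by rewrite lerD2l lef_pV2 ?posrE// ler_nat.
rewrite -[leRHS]addr0.
apply: (ler_cvg_to (cvg_cst _) (cvgD (cvg_cst _) cvgD0)).
exact: (nearW _ bnd).
Qed.

End moments.

(** The one-dimensional moment problem on [0, 1], with a weight [h]. The weight is
what allows several variables to be treated one after the other. *)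
Lemma sublevel_agree d (Y : measurableType d) (R : realType)
    (Q1 Q2 : probability Y R) h x a : unit_valued h -> unit_valued x ->
  (forall n, \int[Q1]_y (h y * x y ^+ n) = \int[Q2]_y (h y * x y ^+ n)) ->
  \int[Q1]_y (h y * \1_(sublevel x a) y) =
  \int[Q2]_y (h y * \1_(sublevel x a) y).
Proof.
move=> uh ux agree; apply/eqP; rewrite eq_le.
by rewrite !sublevel_agree_le// => n; rewrite agree.
Qed.

(** * Uniqueness on the cylinder sigma-algebra *)

Section uniqueness.
Context (R : realType) (S : ptopologicalType).
Local Notation M := (borelType (borel_prob S R)).
Local Notation event := (R * set (borelType S))%type.
Implicit Types (l : seq (set (borelType S))) (s : seq event).

Definition monomial l (mu : M) : R := \prod_(B <- l) mass B mu.

Definition box_indicator s (mu : M) : R :=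
  \prod_(e <- s) \1_(sublevel (mass e.2 : M -> R) e.1) mu.

Definition box s : set M := [set mu | forall e, e \in s -> mass e.2 mu <= e.1].

Lemma unit_valued_mass (B : set (borelType S)) : measurable B ->
  unit_valued (mass B : M -> R).
Proof.
by move=> mB; split; [exact: measurable_mass|move=> mu; exact: mass01].
Qed.

Lemma unit_valued1 : unit_valued (fun _ : M => 1 : R).
Proof. by split => // y; rewrite ler01 lexx. Qed.

Lemma unit_valued_monomial l : (forall B, B \in l -> measurable B) ->
  unit_valued (monomial l).
Proof.
elim: l => [_|B l IH ml].
  by rewrite (_ : monomial _ = fun=> 1); [exact: unit_valued1|
    apply/funext => mu; rewrite /monomial big_nil].
rewrite (_ : monomial _ = fun mu => mass B mu * monomial l mu).
  apply: unit_valuedM; first by apply: unit_valued_mass; apply: ml; rewrite inE eqxx.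
  by apply: IH => C Cl; apply: ml; rewrite inE Cl orbT.
by apply/funext => mu; rewrite /monomial big_cons.
Qed.

Lemma unit_valued_box_indicator s : (forall e, e \in s -> measurable e.2) ->
  unit_valued (box_indicator s).
Proof.
elim: s => [_|e s IH ms].
  by rewrite (_ : box_indicator _ = fun=> 1); [exact: unit_valued1|
    apply/funext => mu; rewrite /box_indicator big_nil].
rewrite (_ : box_indicator _ =
    fun mu => \1_(sublevel (mass e.2 : M -> R) e.1) mu * box_indicator s mu).
  apply: unit_valuedM; last by apply: IH => C Cl; apply: ms; rewrite inE Cl orbT.
  by apply: unit_valued_sublevel; apply: measurable_mass; apply: ms; rewrite inE eqxx.
by apply/funext => mu; rewrite /box_indicator big_cons.
Qed.

Variables (Q1 Q2 : probability M R).
Hypothesis agree : forall l, (forall B, B \in l -> measurable B) ->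
  \int[Q1]_mu monomial l mu = \int[Q2]_mu monomial l mu.

(** Induction on the number of indicators: a power of the next mass is absorbed
by the monomial, and [sublevel_agree] trades these powers for an indicator. *)
Lemma box_monomial_agree s l : (forall e, e \in s -> measurable e.2) ->
  (forall B, B \in l -> measurable B) ->
  \int[Q1]_mu (monomial l mu * box_indicator s mu) =
  \int[Q2]_mu (monomial l mu * box_indicator s mu).
Proof.
elim: s l => [|[a B] s IH] l ms ml.
  under eq_Rintegral do rewrite /box_indicator big_nil mulr1.
  under [RHS]eq_Rintegral do rewrite /box_indicator big_nil mulr1.
  exact: agree.
have mB : measurable B by apply: (ms (a, B)); rewrite inE eqxx.
have ms' e : e \in s -> measurable e.2 by move=> es; apply: ms; rewrite inE es orbT.
have E mu : monomial l mu * box_indicator ((a, B) :: s) mu =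
    (monomial l mu * box_indicator s mu) * \1_(sublevel (mass B : M -> R) a) mu.
  by rewrite /box_indicator big_cons/= mulrCA mulrC.
under eq_Rintegral do rewrite E.
under [RHS]eq_Rintegral do rewrite E.
apply: sublevel_agree.
- apply: unit_valuedM; first exact: unit_valued_monomial.
  exact: unit_valued_box_indicator.
- exact: unit_valued_mass.
move=> n.
have E' mu : monomial l mu * box_indicator s mu * mass B mu ^+ n =
    monomial (nseq n B ++ l) mu * box_indicator s mu.
  rewrite /monomial big_cat/= big_nseq mulrAC; congr (_ * _).
  by rewrite iter_mulr_1 mulrC.
under eq_Rintegral do rewrite E'.
under [RHS]eq_Rintegral do rewrite E'.
apply: IH => // C; rewrite mem_cat => /orP[/nseqP[-> _]//|]; exact: ml.
Qed.

Lemma box_indicatorE s : box_indicator s = \1_(box s).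
Proof.
apply/funext => mu; elim: s => [|e s IH].
  by rewrite /box_indicator big_nil indicE mem_set.
rewrite /box_indicator big_cons -/(box_indicator s mu) IH !indicE.
rewrite -natrM mulnb; congr (nat_of_bool _)%:R.
apply/idP/idP.
  move=> /andP[]; rewrite !inE => h1 h2 e'; rewrite inE => /orP[/eqP->//|].
  exact: h2.
rewrite inE => h; apply/andP; split; rewrite inE; first by apply: h; rewrite inE eqxx.
by move=> e' es; apply: h; rewrite inE es orbT.
Qed.

Lemma box_nil : box [::] = setT.
Proof. by apply/seteqP; split => // mu _ e. Qed.

Lemma measurable_box s : (forall e, e \in s -> measurable e.2) ->
  measurable (box s).
Proof.
elim: s => [_|e s IH ms].
  by rewrite box_nil.
rewrite (_ : box _ = sublevel (mass e.2 : M -> R) e.1 `&` box s).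
  apply: measurableI; last by apply: IH => C Cl; apply: ms; rewrite inE Cl orbT.
  by apply: measurable_sublevel; apply: measurable_mass; apply: ms; rewrite inE eqxx.
apply/seteqP; split => mu.
  move=> h; split; first by apply: h; rewrite inE eqxx.
  by move=> e' es; apply: h; rewrite inE es orbT.
by move=> [h1 h2] e'; rewrite inE => /orP[/eqP->//|]; exact: h2.
Qed.

Lemma box_agree s : (forall e, e \in s -> measurable e.2) ->
  Q1 (box s) = Q2 (box s).
Proof.
move=> ms; have mb := measurable_box ms.
rewrite -(EFin_fine_measure Q1 mb) -(EFin_fine_measure Q2 mb).
rewrite -!Rintegral_indic// -box_indicatorE.
have E (Q : probability M R) : \int[Q]_mu box_indicator s mu =
    \int[Q]_mu (monomial [::] mu * box_indicator s mu).
  by apply: eq_Rintegral => mu _; rewrite /monomial big_nil mul1r.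
by rewrite !E (@box_monomial_agree s [::] ms).
Qed.

Definition boxes : set (set M) :=
  [set box s | s in [set s : seq event | forall e : event, e \in s -> measurable e.2]].

(** Complements of boxes with a single side are the superlevel sets of the
evaluations. *)
Lemma cylinder_sub_boxes : @cylinder S R `<=` <<s boxes >>.
Proof.
apply: smallest_sub; first exact: smallest_sigma_algebra.
move=> U [B mB [A mA <-]].
pose T := g_sigma_algebraType boxes.
have mm : measurable_fun [set: T] (mass B : T -> R).
  apply: (measurability _ (RGenOInfty.measurableE R)).
  move=> _ [_ [a ->] <-]; rewrite setTI.
  rewrite (_ : _ @^-1` _ = ~` (box [:: (a, B)] : set T)).
    apply: measurableC; apply: sub_sigma_algebra; exists [:: (a, B)] => //.
    by move=> e; rewrite inE => /eqP->.
  apply/seteqP; split => mu /=; rewrite in_itv/= andbT.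
    by move=> aB /(_ (a, B) (mem_head _ _)) /=; rewrite leNgt aB.
  move=> h; rewrite ltNge; apply/negP => Ba; apply: h => e.
  by rewrite inE => /eqP->.
have mE : measurable_fun [set: T] (fun mu : T => (mass B mu)%:E).
  exact/measurable_EFinP.
have := mE measurableT A mA.
rewrite (_ : (fun mu : T => _) = (fun mu : borel_prob S R => mu B))//.
by apply/funext => mu; exact: EFin_mass.
Qed.

Lemma cylinder_unique (C : set (borel_prob S R)) : cylinder C -> Q1 C = Q2 C.
Proof.
move=> /cylinder_sub_boxes; move: C.
apply: (@g_sigma_algebra_measure_unique _ R M boxes _ (fun=> setT) _ _ Q1 Q2).
- by move=> _ [s ms <-]; exact: measurable_box.
- by move=> _; exists [::]; [move=> e|exact: box_nil].
- by rewrite bigcup_const.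
- move=> _ _ [s ms <-] [s' ms' <-]; exists (s ++ s').
    by move=> e; rewrite mem_cat => /orP[/ms|/ms'].
  apply/seteqP; split => mu.
    by move=> h; split => e es; apply: h; rewrite mem_cat es ?orbT.
  by move=> [h h'] e; rewrite mem_cat => /orP[/h|/h'].
- by move=> _ [s ms <-]; exact: box_agree.
- by move=> _; rewrite [ltLHS]probability_setT ltry.
Qed.

End uniqueness.

Lemma mixture_unique (R : realType) (S : ptopologicalType)
    (d : measure_display) (Omega : measurableType d) (P : probability Omega R)
    (X : nat -> {RV P >-> borelType S})
    (Q1 Q2 : probability (borelType (borel_prob S R)) R) :
  mixture_of_iid X Q1 -> mixture_of_iid X Q2 ->
  forall C : set (borel_prob S R), cylinder C -> Q1 C = Q2 C.
Proof.
move=> mQ1 mQ2; apply: cylinder_unique => l ml.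
pose B (i : 'I_(size l)) := nth set0 l i.
have mB i : measurable (B i) by apply: ml; exact: mem_nth.
have E (Q : probability (borelType (borel_prob S R)) R) : mixture_of_iid X Q ->
    (\int[Q]_mu monomial l mu)%:E = P [set w | forall i, B i (X i w)].
  move=> mQ; rewrite mQ//; under eq_integral do rewrite prod_mass//.
  rewrite -EFin_Rintegral; last exact/unit_valued_integrable/unit_valued_monomial.
  apply: eq_integral => mu _; congr EFin.
  by rewrite /monomial (big_nth set0) big_mkord.
by have := E _ mQ1; rewrite -(E _ mQ2) => -[].
Qed.

Theorem theorem2p5 (R : realType) (S : ptopologicalType)
    (hS : hausdorff_space S)
    (d : measure_display) (Omega : measurableType d) (P : probability Omega R)
    (X : nat -> {RV P >-> borelType S})
    (exchX : exchangeable X)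
    (radonX : radon (distribution P (X 0%N))) :
  (exists Q : probability (borelType (borel_prob S R)) R, mixture_of_iid X Q) /\
  (forall Q1 Q2 : probability (borelType (borel_prob S R)) R,
     mixture_of_iid X Q1 -> mixture_of_iid X Q2 ->
     forall C : set (borel_prob S R), cylinder C -> Q1 C = Q2 C).
Proof.
split; first exact: mixture_exists.
by move=> Q1 Q2; exact: mixture_unique.
Qed.
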